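(* Let $(H,R)$ be a semisimple quasi-triangular Hopf algebra over a field $k$ of characteristic zero, and let $A$ be a strongly separable quantum commutative left $H$-module algebra with symmetric separability idempotent $x=x^1\otimes x^2$. Equip $A\#H$ with the comultiplication and counit $$\tilde\Delta(a\#h)=a(R^2\cdot x^1)\#R^1h_{(1)}\otimes x^2\#h_{(2)},\qquad \tilde\varepsilon(a\#h)=\langle\alpha_A,a\rangle\varepsilon(h)\qquad(a\in A,\ h\in H).$$ Suppose that the Drinfeld element $u=S(R^2)R^1$ acts trivially on $A$, i.e. $u\cdot a=a$ for all $a\in A$. Then $A\#H$ is a weak Hopf algebra, with antipode $$\tilde S(a\#h)=(1_A\#S(h))(R^2\cdot a\#R^1).$$ Furthermore, if $A$ belongs to the M\''uger center of ${}_H\mathcal M$, i.e. $(R_2^2R_1^1)\cdot a\otimes R_2^1R_1^2=a\otimes 1_H$ for all $a\in A$, then $(A\#H,\mathcal R)$ is a quasi-triangular weak Hopf algebra with R-matrix $$\mathcal R=\tilde 1_{(2)}(1_A\#R^1)\tilde 1_{(1')}\otimes\tilde 1_{(1)}(1_A\#R^2)\tilde 1_{(2')},$$ where $\tilde 1_{(1)}\otimes\tilde 1_{(2)}=\tilde 1_{(1')}\otimes\tilde 1_{(2')}=\tilde\Delta(1_A\#1_H)$. If in addition $(H,R)$ is triangular, then $(A\#H,\mathcal R)$ is also triangular.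
   Context: All algebras and coalgebras are over $k$; Sweedler notation $\Delta(h)=h_{(1)}\otimes h_{(2)}$ is used and $S$ is the antipode of $H$. A quasi-triangular Hopf algebra is a pair $(H,R)$, $R=R^1\otimes R^2\in H\otimes H$ invertible, with $R^1h_{(1)}\otimes R^2h_{(2)}=h_{(2)}R^1\otimes h_{(1)}R^2$ for all $h\in H$, $(\Delta\otimes id)(R)=R_1^1\otimes R_2^1\otimes R_1^2R_2^2$, $(id\otimes\Delta)(R)=R_1^1R_2^1\otimes R_2^2\otimes R_1^2$. Here $R_i=R_i^1\otimes R_i^2$ ($i=1,2,\dots$) are copies of $R$ (lower index: copy; upper index: tensor leg). $(H,R)$ is triangular if $R^{21}R=1\otimes1$, where $R^{21}=R^2\otimes R^1$. A left $H$-module algebra $A$ is quantum commutative if $ab=(R^2\cdot b)(R^1\cdot a)$ for all $a,b\in A$. $A$ is strongly separable if it has a symmetric separability idempotent $x=x^1\otimes x^2\in A\otimes A$, i.e. $ax^1\otimes x^2=x^1\otimes x^2a$ for $a\in A$, $x^1x^2=1_A$, $x^1\otimes x^2=x^2\otimes x^1$. $\alpha_A\in A^*$ is the element determined by $\langle\alpha_A,x^1\rangle x^2=1_A$. The smash product $A\#H$ is $A\otimes H$ with multiplication $(a\#h)(b\#g)=a(h_{(1)}\cdot b)\#h_{(2)}g$ and unit $1_A\#1_H$. ${}_H\mathcal M$ is the braided category of finite dimensional left $H$-modules. A quasi-triangular weak Hopf algebra is a weak Hopf algebra $L$ with $\mathcal R\in\Delta^{cop}(1)(L\otimes L)\Delta(1)$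 such that $\Delta^{cop}(l)\mathcal R=\mathcal R\Delta(l)$ for $l\in L$, $(id\otimes\Delta)\mathcal R=\mathcal R^{13}\mathcal R^{12}$, $(\Delta\otimes id)\mathcal R=\mathcal R^{13}\mathcal R^{23}$, and there is $\bar{\mathcal R}\in\Delta(1)(L\otimes L)\Delta^{cop}(1)$ with $\bar{\mathcal R}\mathcal R=\Delta(1)$, $\mathcal R\bar{\mathcal R}=\Delta^{cop}(1)$. It is triangular if $\mathcal R^{21}\mathcal R=\Delta(1)$. *)

(* Defs.v *)
From HB Require Import structures.
From mathcomp Require Import all_boot all_algebra all_field.

Set Implicit Arguments.
Unset Strict Implicit.
Unset Printing Implicit Defensive.

Import GRing.Theory.
Local Open Scope ring_scope.

Reserved Notation "u \ox v" (at level 40, left associativity).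
Reserved Notation "a \sm h" (at level 40, left associativity).
Reserved Notation "\sw_ ( a , b <- t ) E"
  (at level 41, a name, b name, t at level 50, E at level 41,
   format "'[' \sw_ ( a ,  b  <-  t ) '/  '  E ']'").

(* The tensor product of two finite dimensional spaces: the matrices of
   coordinates with respect to the products of the vectors of the bases
   vbasis {:U} and vbasis {:V}.                                               *)
Definition tensor (k : fieldType) (U V : vectType k) : Type :=
  'M[k]_(\dim {:U}, \dim {:V}).

HB.instance Definition _ (k : fieldType) (U V : vectType k) :=
  Vector.copy (tensor U V) 'M[k]_(\dim {:U}, \dim {:V}).

Definition tens (k : fieldType) (U V : vectType k) (u : U) (v : V) :
    tensor U V :=
  \matrix_(i, j) (coord (vbasis {:U}) i u * coord (vbasis {:V}) j v).

Notation "u \ox v" := (tens u v) : ring_scope.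

(* The linear extension of a bilinear E : U -> V -> W to U (x) V. The notation
   \sw_(a, b <- t) E is E(t^1, t^2) for t = t^1 (x) t^2 written as a sum of
   pure tensors with the summation sign omitted (as in Sweedler notation); it
   is meaningful when E is bilinear in (a, b), see tlift_tens.                *)
Definition tlift (k : fieldType) (U V : vectType k) (W : lmodType k)
    (E : U -> V -> W) (t : tensor U V) : W :=
  \sum_i \sum_j t i j *: E (vbasis {:U})`_i (vbasis {:V})`_j.

Notation "\sw_ ( a , b <- t ) E" := (tlift (fun a b => E) t) : ring_scope.

Definition bilin (k : fieldType) (U V : vectType k) (W : lmodType k)
    (E : U -> V -> W) : Prop :=
  (forall v, linear (E^~ v)) /\ (forall u, linear (E u)).

Section TensorTheory.

Variable k : fieldType.
Implicit Types U V : vectType k.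
Implicit Types W : lmodType k.

Lemma tens_bilin U V : bilin (@tens k U V).
Proof.
split=> [v c x y|u c x y]; apply/matrixP=> i j; rewrite !mxE linearP /=.
  by rewrite mulrDl mulrA.
by rewrite mulrDr mulrCA.
Qed.

Lemma tlift_linear U V W (E : U -> V -> W) : linear (tlift E).
Proof.
move=> c s t; rewrite /tlift scaler_sumr -big_split /=; apply: eq_bigr => i _.
rewrite scaler_sumr -big_split /=; apply: eq_bigr => j _.
by rewrite !mxE scalerDl scalerA.
Qed.

Lemma tlift_tens U V W (E : U -> V -> W) u v :
  bilin E -> \sw_(a, b <- u \ox v) E a b = E u v.
Proof.
case=> El Er.
have E0l b : E 0 b = 0 by have := El b (-1) 0 0; rewrite scaler0 add0r scaleN1r addNr.
have E0r a : E a 0 = 0 by have := Er a (-1) 0 0; rewrite scaler0 add0r scaleN1r addNr.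
have Esl I (r : seq I) (F : I -> k) (G : I -> U) b :
    E (\sum_(i <- r) F i *: G i) b = \sum_(i <- r) F i *: E (G i) b.
  by elim: r => [|i r IH]; rewrite ?big_nil ?E0l // !big_cons El IH.
have Esr I (r : seq I) (F : I -> k) (G : I -> V) a :
    E a (\sum_(i <- r) F i *: G i) = \sum_(i <- r) F i *: E a (G i).
  by elim: r => [|i r IH]; rewrite ?big_nil ?E0r // !big_cons Er IH.
rewrite [in RHS](coord_vbasis (memvf u)) Esl; apply: eq_bigr => i _.
rewrite [in RHS](coord_vbasis (memvf v)) Esr scaler_sumr; apply: eq_bigr => j _.
by rewrite mxE scalerA.
Qed.

Lemma tens_sum U V (t : tensor U V) : t = \sw_(a, b <- t) a \ox b.
Proof.
apply/matrixP=> i j; rewrite summxE (bigD1 i) //= summxE (bigD1 j) //= !mxE.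
have fU := basis_free (vbasisP {:U}); have fV := basis_free (vbasisP {:V}).
rewrite !coord_free // !eqxx !mulr1 !big1 ?addr0 // => [i' Ni|j' Nj].
  rewrite summxE big1 // => j' _; rewrite !mxE coord_free // (negPf Ni).
  by rewrite mul0r mulr0.
by rewrite !mxE !coord_free // (negPf Nj) !mulr0.
Qed.

Lemma tens_ind U V (P : tensor U V -> Prop) :
    P 0 -> (forall s t, P s -> P t -> P (s + t)) ->
  (forall u v, P (u \ox v)) -> forall t, P t.
Proof.
move=> P0 PD Pt t; rewrite [t]tens_sum.
apply: big_ind => // i _; apply: big_ind => // j _.
suff ->: t i j *: ((vbasis {:U})`_i \ox (vbasis {:V})`_j)
       = (t i j *: (vbasis {:U})`_i) \ox (vbasis {:V})`_j by apply: Pt.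
by apply/matrixP=> p q; rewrite !mxE linearZ mulrA.
Qed.

Lemma linear_tlift U V W W' (f : W -> W') (E : U -> V -> W) t :
  linear f -> f (\sw_(a, b <- t) E a b) = \sw_(a, b <- t) f (E a b).
Proof.
move=> fL; pose f' : {linear W -> W'} := HB.pack f (GRing.isLinear.Build _ _ _ _ _ fL).
rewrite -[f]/(f' : W -> W') linear_sum; apply: eq_bigr => i _.
by rewrite linear_sum; apply: eq_bigr => j _; rewrite linearZ.
Qed.

Lemma eq_tlift U V W (E F : U -> V -> W) t :
  E =2 F -> \sw_(a, b <- t) E a b = \sw_(a, b <- t) F a b.
Proof. by move=> EF; apply: eq_bigr => i _; apply: eq_bigr => j _; rewrite EF. Qed.

Lemma tlift_linear_par U V W (X : lmodType k) (E : X -> U -> V -> W) t :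
  (forall a b, linear (fun z => E z a b)) ->
  linear (fun z => \sw_(a, b <- t) E z a b).
Proof.
move=> EL c x y; rewrite /tlift scaler_sumr -big_split /=; apply: eq_bigr => p _.
rewrite scaler_sumr -big_split /=; apply: eq_bigr => q _.
by rewrite EL scalerDr !scalerA mulrC.
Qed.

Lemma tlift2_tens U V U' V' W (M : U -> V -> U' -> V' -> W) u v u' v' :
    (forall c d, bilin (fun a b => M a b c d)) -> (forall a b, bilin (M a b)) ->
  \sw_(a, b <- u \ox v) (\sw_(c, d <- u' \ox v') M a b c d) = M u v u' v'.
Proof.
move=> Ml Mr; rewrite tlift_tens; first exact: tlift_tens.
by split=> [b|a]; apply: tlift_linear_par => c d; have [] := Ml c d.
Qed.

Lemma tens_neq0 U V (u : U) (v : V) : u != 0 -> v != 0 -> u \ox v != 0.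
Proof.
have nz (W : vectType k) (w : W) : w != 0 -> exists i, coord (vbasis {:W}) i w != 0.
  move=> w0; apply/existsP; apply: contraNT w0; rewrite negb_exists => /forallP w0.
  rewrite (coord_vbasis (memvf w)) big1 // => i _.
  by have /negPn/eqP -> := w0 i; rewrite scale0r.
move=> /nz[i ui] /nz[j vj]; apply/eqP => /matrixP/(_ i j)/eqP.
by rewrite !mxE mulf_eq0 (negPf ui) (negPf vj).
Qed.

Lemma exchange_tlift U V U' V' W (E : U -> V -> U' -> V' -> W) s t :
  \sw_(a, b <- s) (\sw_(c, d <- t) E a b c d)
  = \sw_(c, d <- t) (\sw_(a, b <- s) E a b c d).
Proof.
have tE (U1 V1 : vectType k) W1 (F : U1 -> V1 -> W1) r :
    tlift F r = \sum_p r p.1 p.2 *: F (vbasis {:U1})`_p.1 (vbasis {:V1})`_p.2.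
  by rewrite /tlift pair_big.
rewrite !tE; under eq_bigr do rewrite tE scaler_sumr.
under [RHS]eq_bigr do rewrite tE scaler_sumr.
rewrite exchange_big; apply: eq_bigr => i _; apply: eq_bigr => j _.
by rewrite !scalerA mulrC.
Qed.

End TensorTheory.

Section TensorAlgebra.

Variables (k : fieldType) (A B : falgType k).
Implicit Types p q r : tensor A B.

Definition tens_mul p q : tensor A B :=
  \sw_(a, b <- p) \sw_(c, d <- q) (a * c) \ox (b * d).

Let tL := (tens_bilin A B).1.
Let tR := (tens_bilin A B).2.

Lemma tens_mulE (a c : A) (b d : B) :
  tens_mul (a \ox b) (c \ox d) = (a * c) \ox (b * d).
Proof.
rewrite /tens_mul tlift2_tens // => [{a b}c' d'|a' b']; split=> [v|u] e x y.
- by rewrite mulrDl -scalerAl tL.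
- by rewrite mulrDl -scalerAl tR.
- by rewrite mulrDr -scalerAr tL.
- by rewrite mulrDr -scalerAr tR.
Qed.

Lemma tens_mul_linl q : linear (tens_mul^~ q).
Proof. exact: tlift_linear. Qed.

Lemma tens_mul_linr p : linear (tens_mul p).
Proof. by apply: tlift_linear_par => a b; apply: tlift_linear. Qed.

Let mDl : left_distributive tens_mul +%R.
Proof. by move=> x y z; have := tens_mul_linl z 1 x y; rewrite !scale1r. Qed.
Let mDr : right_distributive tens_mul +%R.
Proof. by move=> x y z; have := tens_mul_linr x 1 y z; rewrite !scale1r. Qed.
Let m0l q : tens_mul 0 q = 0.
Proof. by apply: (addIr (tens_mul 0 q)); rewrite -mDl !add0r. Qed.
Let m0r q : tens_mul q 0 = 0.
Proof. by apply: (addIr (tens_mul q 0)); rewrite -mDr !add0r. Qed.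

Lemma tens_mulA : associative tens_mul.
Proof.
elim/tens_ind => [|p p' IH IH'|a b] q r; rewrite ?m0l ?mDl ?IH ?IH' //.
elim/tens_ind: q => [|q q' IH IH'|c d]; rewrite ?(m0l, m0r, mDl, mDr) ?IH ?IH' //.
elim/tens_ind: r => [|r r' IH IH'|e f]; rewrite ?(m0l, m0r, mDl, mDr) ?IH ?IH' //.
by rewrite !tens_mulE !mulrA.
Qed.

Lemma tens_mul1 : left_id (1 \ox 1) tens_mul.
Proof.
elim/tens_ind => [|p p' IH IH'|a b]; rewrite ?(m0r, mDr) ?IH ?IH' //.
by rewrite tens_mulE !mul1r.
Qed.

Lemma tens_1mul : right_id (1 \ox 1) tens_mul.
Proof.
elim/tens_ind => [|p p' IH IH'|a b]; rewrite ?(m0l, mDl) ?IH ?IH' //.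
by rewrite tens_mulE !mulr1.
Qed.

Lemma tens1_neq0 : (1 \ox 1 : tensor A B) != 0.
Proof. by rewrite tens_neq0 ?oner_neq0. Qed.

Lemma tens_scalerAl c p q : c *: tens_mul p q = tens_mul (c *: p) q.
Proof. by have := tens_mul_linl q c p 0; rewrite m0l !addr0. Qed.

Lemma tens_scalerAr c p q : c *: tens_mul p q = tens_mul p (c *: q).
Proof. by have := tens_mul_linr p c q 0; rewrite m0r !addr0. Qed.

HB.instance Definition _ := GRing.Zmodule_isNzRing.Build (tensor A B)
  tens_mulA tens_mul1 tens_1mul mDl mDr tens1_neq0.
HB.instance Definition _ := GRing.Lmodule_isLalgebra.Build k (tensor A B)
  tens_scalerAl.
HB.instance Definition _ := GRing.Lalgebra_isAlgebra.Build k (tensor A B)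
  tens_scalerAr.
HB.instance Definition _ := Algebra_isFalgebra.Build k (tensor A B).

End TensorAlgebra.

Section HopfDefs.

Variable k : fieldType.

Definition flip (U V : vectType k) (t : tensor U V) : tensor V U :=
  \sw_(a, b <- t) b \ox a.

Record is_coalgebra (C : vectType k) (Delta : C -> tensor C C) (eps : C -> k) :
    Prop := IsCoalgebra {
  comul_linear : linear Delta;
  counit_scalar : scalar eps;
  comulA : forall c, \sw_(c1, c2 <- Delta c) Delta c1 \ox c2
    = \sw_(c1, c2 <- Delta c) \sw_(c21, c22 <- Delta c2) c1 \ox c21 \ox c22;
  counitl : forall c, \sw_(c1, c2 <- Delta c) eps c1 *: c2 = c;
  counitr : forall c, \sw_(c1, c2 <- Delta c) eps c2 *: c1 = c
}.

Record is_hopf (H : falgType k) (Delta : H -> tensor H H) (eps : H -> k)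
    (S : H -> H) : Prop := IsHopf {
  hopf_coalgebra : is_coalgebra Delta eps;
  comul1 : Delta 1 = 1;
  comulM : forall g h, Delta (g * h) = Delta g * Delta h;
  counit1 : eps 1 = 1;
  counitM : forall g h, eps (g * h) = eps g * eps h;
  antipode_linear : linear S;
  antipodel : forall h, \sw_(h1, h2 <- Delta h) S h1 * h2 = (eps h)%:A;
  antipoder : forall h, \sw_(h1, h2 <- Delta h) h1 * S h2 = (eps h)%:A
}.

(* t^12, t^13 and t^23 in L (x) L (x) L *)
Definition leg12 (L : falgType k) (t : tensor L L) : tensor (tensor L L) L :=
  \sw_(a, b <- t) a \ox b \ox 1.
Definition leg13 (L : falgType k) (t : tensor L L) : tensor (tensor L L) L :=
  \sw_(a, b <- t) a \ox 1 \ox b.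
Definition leg23 (L : falgType k) (t : tensor L L) : tensor (tensor L L) L :=
  \sw_(a, b <- t) 1 \ox a \ox b.

(* Weak Hopf algebras in the sense of Boehm, Nill and Szlachanyi. *)
Record is_weak_hopf (L : falgType k) (Delta : L -> tensor L L) (eps : L -> k)
    (S : L -> L) : Prop := IsWeakHopf {
  weak_coalgebra : is_coalgebra Delta eps;
  weak_comulM : forall x y, Delta (x * y) = Delta x * Delta y;
  weak_counitMl : forall x y z, eps (x * y * z)
    = \sw_(y1, y2 <- Delta y) (eps (x * y1) * eps (y2 * z) : k^o);
  weak_counitMr : forall x y z, eps (x * y * z)
    = \sw_(y1, y2 <- Delta y) (eps (x * y2) * eps (y1 * z) : k^o);
  weak_comul1l : \sw_(e1, e2 <- Delta 1) Delta e1 \ox e2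
    = leg12 (Delta 1) * leg23 (Delta 1);
  weak_comul1r : \sw_(e1, e2 <- Delta 1) Delta e1 \ox e2
    = leg23 (Delta 1) * leg12 (Delta 1);
  weak_antipode_linear : linear S;
  weak_antipoder : forall x, \sw_(x1, x2 <- Delta x) x1 * S x2
    = \sw_(e1, e2 <- Delta 1) eps (e1 * x) *: e2;
  weak_antipodel : forall x, \sw_(x1, x2 <- Delta x) S x1 * x2
    = \sw_(e1, e2 <- Delta 1) eps (x * e2) *: e1;
  weak_antipodeK : forall x, \sw_(y, x3 <- Delta x)
    \sw_(x1, x2 <- Delta y) S x1 * x2 * S x3 = S x
}.

Record is_quasitriangular_weak_hopf (L : falgType k) (Delta : L -> tensor L L)
    (eps : L -> k) (S : L -> L) (RR : tensor L L) : Prop :=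
    IsQuasitriangularWeakHopf {
  qtw_weak_hopf : is_weak_hopf Delta eps S;
  qtw_mem : exists t, RR = flip (Delta 1) * t * Delta 1;
  qtw_comulC : forall l, flip (Delta l) * RR = RR * Delta l;
  qtw_comulr : \sw_(r1, r2 <- RR) \sw_(a, b <- Delta r2) r1 \ox a \ox b
    = leg13 RR * leg12 RR;
  qtw_comull : \sw_(r1, r2 <- RR) Delta r1 \ox r2 = leg13 RR * leg23 RR;
  qtw_inverse : exists RRbar,
    [/\ exists t, RRbar = Delta 1 * t * flip (Delta 1),
        RRbar * RR = Delta 1
      & RR * RRbar = flip (Delta 1)]
}.

Definition is_triangular_weak_hopf (L : falgType k) (Delta : L -> tensor L L)
    (eps : L -> k) (S : L -> L) (RR : tensor L L) : Prop :=
  is_quasitriangular_weak_hopf Delta eps S RR /\ flip RR * RR = Delta 1.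

(* The regular left module is semisimple: every left ideal has a complementary
   left ideal.                                                                *)
Definition semisimple (B : falgType k) : Prop :=
  forall I : {vspace B}, ({:B} * I <= I)%VS ->
  exists J : {vspace B},
    [/\ ({:B} * J <= J)%VS, (I + J = {:B})%VS & (I :&: J = 0)%VS].

Definition symmetric_separability_idempotent (B : falgType k)
    (x : tensor B B) : Prop :=
  [/\ forall b, \sw_(x1, x2 <- x) (b * x1) \ox x2
              = \sw_(x1, x2 <- x) x1 \ox (x2 * b),
      \sw_(x1, x2 <- x) x1 * x2 = 1
    & flip x = x].

End HopfDefs.

(* In a falgType the dimension is finite. This is automatic for the Hopf and
   module algebras under consideration: a semisimple Hopf algebra is finite
   dimensional, and so is a separable algebra over a field.                   *)
Record hopfAlg (k : fieldType) := HopfAlg {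
  hopf_alg :> falgType k;
  comul : hopf_alg -> tensor hopf_alg hopf_alg;
  counit : hopf_alg -> k;
  antipode : hopf_alg -> hopf_alg;
  hopfP : is_hopf comul counit antipode
}.

Record modAlg (k : fieldType) (H : hopfAlg k) := ModAlg {
  mod_alg :> falgType k;
  act : H -> mod_alg -> mod_alg;
  act_bilin : bilin act;
  act_id : forall a, act 1 a = a;
  act_comp : forall g h a, act (g * h) a = act g (act h a);
  act_one : forall h, act h 1 = (counit h)%:A;
  act_mul : forall h a b,
    act h (a * b) = \sw_(h1, h2 <- comul h) act h1 a * act h2 b
}.

Record quasitriangular (k : fieldType) (H : hopfAlg k) (R : tensor H H) :
    Prop := Quasitriangular {
  qt_unit : R \is a GRing.unit;
  qt_comulC : forall h, R * comul h = flip (comul h) * R;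
  qt_comull : \sw_(r1, r2 <- R) comul r1 \ox r2
    = \sw_(r11, r12 <- R) \sw_(r21, r22 <- R) r11 \ox r21 \ox (r12 * r22);
  qt_comulr : \sw_(r1, r2 <- R) \sw_(a, b <- comul r2) r1 \ox a \ox b
    = \sw_(r11, r12 <- R) \sw_(r21, r22 <- R) (r11 * r21) \ox r22 \ox r12
}.

Definition triangular (k : fieldType) (H : hopfAlg k) (R : tensor H H) : Prop :=
  quasitriangular R /\ flip R * R = 1.

Definition drinfeld (k : fieldType) (H : hopfAlg k) (R : tensor H H) : H :=
  \sw_(r1, r2 <- R) antipode r2 * r1.

Section ModuleAlgebras.

Variables (k : fieldType) (H : hopfAlg k) (A : modAlg H).
Implicit Type R : tensor H H.

Definition quantum_commutative R : Prop :=
  forall a b : A, a * b = \sw_(r1, r2 <- R) act r2 b * act r1 a.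

Definition in_mueger_center R : Prop :=
  forall a : A,
    \sw_(r11, r12 <- R) \sw_(r21, r22 <- R) act (r22 * r11) a \ox (r21 * r12)
    = a \ox 1.

Definition smash : Type := tensor A H.

HB.instance Definition _ := Vector.copy smash (tensor A H).

Definition smel (a : A) (h : H) : smash := a \ox h.

End ModuleAlgebras.

Notation "a \sm h" := (smel a h) : ring_scope.

Section SmashAlgebra.

Variables (k : fieldType) (H : hopfAlg k) (A : modAlg H).
Implicit Types p q r : smash A.

Definition smash_mul p q : smash A :=
  \sw_(a, h <- p) \sw_(b, g <- q) \sw_(h1, h2 <- comul h)
    (a * act h1 b) \sm (h2 * g).

Let M (a : A) (h : H) (b : A) (g : H) : smash A :=
  \sw_(h1, h2 <- comul h) (a * act h1 b) \sm (h2 * g).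

Let cL : linear (@comul k H) := comul_linear (hopf_coalgebra (hopfP H)).
Let sL : forall h : H, linear (fun a : A => a \sm h) := (tens_bilin A H).1.
Let sR : forall a : A, linear (fun h : H => a \sm h) := (tens_bilin A H).2.
Let aL (a : A) : linear (fun h : H => act h a) := (act_bilin A).1 a.
Let aR (h : H) : linear (act h : A -> A) := (act_bilin A).2 h.

Let Ml b g : bilin (fun a h => M a h b g).
Proof.
split=> [h|a]; rewrite /M.
  apply: tlift_linear_par => h1 h2 e x y.
  by rewrite mulrDl -scalerAl sL.
by move=> e x y; rewrite cL tlift_linear.
Qed.

Let Mr a h : bilin (M a h).
Proof.
split=> [g|b]; rewrite /M; apply: tlift_linear_par => h1 h2 e x y.
  by rewrite aR mulrDr -scalerAr sL.
by rewrite mulrDr -scalerAr sR.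
Qed.

Lemma smash_mulE (a b : A) (h g : H) :
  smash_mul (a \sm h) (b \sm g)
  = \sw_(h1, h2 <- comul h) (a * act h1 b) \sm (h2 * g).
Proof. exact: tlift2_tens. Qed.

Lemma smash_mul_linl q : linear (smash_mul^~ q).
Proof. exact: tlift_linear. Qed.

Lemma smash_mul_linr p : linear (smash_mul p).
Proof. by apply: tlift_linear_par => a h; apply: tlift_linear. Qed.

Let mDl : left_distributive smash_mul +%R.
Proof. by move=> x y z; have := smash_mul_linl z 1 x y; rewrite !scale1r. Qed.
Let mDr : right_distributive smash_mul +%R.
Proof. by move=> x y z; have := smash_mul_linr x 1 y z; rewrite !scale1r. Qed.
Let m0l q : smash_mul 0 q = 0.
Proof. by apply: (addIr (smash_mul 0 q)); rewrite -mDl !add0r. Qed.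
Let m0r q : smash_mul q 0 = 0.
Proof. by apply: (addIr (smash_mul q 0)); rewrite -mDr !add0r. Qed.

Lemma smash_ind (P : smash A -> Prop) :
    P 0 -> (forall s t, P s -> P t -> P (s + t)) ->
  (forall a h, P (a \sm h)) -> forall t, P t.
Proof. exact: tens_ind. Qed.

Lemma comul_assoc_tlift (W : lmodType k) (F : H -> H -> H -> W) h :
    (forall c, bilin (fun a b => F a b c)) -> (forall a b, linear (F a b)) ->
  \sw_(h1, h2 <- comul h) \sw_(h11, h12 <- comul h1) F h11 h12 h2
  = \sw_(h1, h2 <- comul h) \sw_(h21, h22 <- comul h2) F h1 h21 h22.
Proof.
move=> F12 F3.
pose G (t : tensor H H) (c : H) := \sw_(a, b <- t) F a b c.
have Gb : bilin G.
  split=> [c|t]; first exact: tlift_linear.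
  by apply: tlift_linear_par => a b; apply: F3.
have GT t c : \sw_(s, d <- t \ox c) G s d = G t c by apply: tlift_tens.
have := congr1 (tlift G) (comulA (hopf_coalgebra (hopfP H)) h).
rewrite !(linear_tlift _ _ (tlift_linear G)) => E.
transitivity (\sw_(h1, h2 <- comul h) tlift G (comul h1 \ox h2)).
  by apply: eq_tlift => a b; rewrite GT.
rewrite E; apply: eq_tlift => a b; rewrite (linear_tlift _ _ (tlift_linear G)).
by apply: eq_tlift => c d; rewrite GT /G tlift_tens.
Qed.

Lemma smash_mulA : associative smash_mul.
Proof.
elim/smash_ind => [|p p' IH IH'|a h] q r; rewrite ?m0l ?mDl ?IH ?IH' //.
elim/smash_ind: q => [|q q' IH IH'|b g]; rewrite ?(m0l, m0r, mDl, mDr) ?IH ?IH' //.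
elim/smash_ind: r => [|r r' IH IH'|c l]; rewrite ?(m0l, m0r, mDl, mDr) ?IH ?IH' //.
rewrite !smash_mulE (linear_tlift _ _ (smash_mul_linr _)).
rewrite (linear_tlift _ _ (smash_mul_linl _)).
transitivity (\sw_(g1, g2 <- comul g) \sw_(h1, h2 <- comul h)
    \sw_(h11, h12 <- comul h1)
      (a * act h11 b * act h12 (act g1 c)) \sm (h2 * g2 * l)).
  apply: eq_tlift => g1 g2; rewrite smash_mulE; apply: eq_tlift => h1 h2.
  rewrite act_mul.
  rewrite (@linear_tlift _ _ _ _ _ (fun z : A => (a * z) \sm (h2 * (g2 * l)))).
    by apply: eq_tlift => h11 h12; rewrite !mulrA.
  by move=> e x y; rewrite mulrDr -scalerAr sL.
rewrite exchange_tlift.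
transitivity (\sw_(h1, h2 <- comul h) \sw_(h11, h12 <- comul h1)
  \sw_(g1, g2 <- comul g)
      (a * act h11 b * act h12 (act g1 c)) \sm (h2 * g2 * l)).
  by apply: eq_tlift => h1 h2; rewrite exchange_tlift.
rewrite (@comul_assoc_tlift _ (fun h11 h12 h2 => \sw_(g1, g2 <- comul g)
      (a * act h11 b * act h12 (act g1 c)) \sm (h2 * g2 * l))).
- apply: eq_tlift => h1 h2; rewrite smash_mulE (comulM (hopfP H)).
  pose F (s t : H) : smash A := (a * act h1 b * act s c) \sm (t * l).
  have Fb : bilin F.
    split=> [t|s] e x y; rewrite /F; first by rewrite aL mulrDr -scalerAr sL.
    by rewrite mulrDl -scalerAl sR.
  rewrite -[RHS]/(tlift F (tens_mul _ _)) (linear_tlift _ _ (tlift_linear F)).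
  apply: eq_tlift => s t; rewrite (linear_tlift _ _ (tlift_linear F)).
  by apply: eq_tlift => s' t'; rewrite tlift_tens // /F act_comp.
- move=> h3; split=> [h2|h1]; apply: tlift_linear_par => g1 g2 e x y.
    by rewrite aL mulrDr mulrDl -scalerAr -scalerAl sL.
  by rewrite aL mulrDr -scalerAr sL.
- move=> h1 h2; apply: tlift_linear_par => g1 g2 e x y.
  by rewrite !mulrDl -!scalerAl sR.
Qed.

Lemma smash_1mul : left_id (1 \sm 1) smash_mul.
Proof.
elim/smash_ind => [|p p' IH IH'|b g]; rewrite ?(m0r, mDr) ?IH ?IH' //.
rewrite smash_mulE (comul1 (hopfP H)) tlift_tens ?act_id ?mul1r //.
split=> [h2|h1] e x y; first by rewrite !mul1r aL sL.
by rewrite mulrDl -scalerAl sR.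
Qed.

Lemma smash_mul1 : right_id (1 \sm 1) smash_mul.
Proof.
elim/smash_ind => [|p p' IH IH'|a h]; rewrite ?(m0l, mDl) ?IH ?IH' //.
rewrite smash_mulE; have [hC _ _ _ _ _ _ _] := hopfP H.
rewrite -[in RHS](counitl hC h) (linear_tlift _ _ (sR a)).
apply: eq_tlift => h1 h2; rewrite act_one mulr1 -scalerAr mulr1.
have smZ (e : k) : (e *: a) \sm h2 = e *: (a \sm h2).
  by apply/matrixP=> i j; rewrite !mxE linearZ mulrA.
by rewrite smZ; apply/matrixP=> i j; rewrite !mxE linearZ mulrCA.
Qed.

Lemma smash1_neq0 : (1 \sm 1 : smash A) != 0.
Proof. exact: tens1_neq0. Qed.

Lemma smash_scalerAl c p q : c *: smash_mul p q = smash_mul (c *: p) q.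
Proof. by have := smash_mul_linl q c p 0; rewrite m0l !addr0. Qed.

Lemma smash_scalerAr c p q : c *: smash_mul p q = smash_mul p (c *: q).
Proof. by have := smash_mul_linr p c q 0; rewrite m0r !addr0. Qed.

HB.instance Definition _ := GRing.Zmodule_isNzRing.Build (smash A)
  smash_mulA smash_1mul smash_mul1 mDl mDr smash1_neq0.
HB.instance Definition _ := GRing.Lmodule_isLalgebra.Build k (smash A)
  smash_scalerAl.
HB.instance Definition _ := GRing.Lalgebra_isAlgebra.Build k (smash A)
  smash_scalerAr.
HB.instance Definition _ := Algebra_isFalgebra.Build k (smash A).

End SmashAlgebra.

Section SmashWeakHopf.

Variables (k : fieldType) (H : hopfAlg k) (A : modAlg H).
Variables (R : tensor H H) (x : tensor A A) (alpha : A -> k).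

Definition smash_comul (z : smash A) : tensor (smash A) (smash A) :=
  \sw_(a, h <- z) \sw_(x1, x2 <- x) \sw_(r1, r2 <- R) \sw_(h1, h2 <- comul h)
    ((a * act r2 x1) \sm (r1 * h1)) \ox (x2 \sm h2).

Definition smash_counit (z : smash A) : k :=
  \sw_(a, h <- z) (alpha a * counit h : k^o).

Definition smash_antipode (z : smash A) : smash A :=
  \sw_(a, h <- z) (1 \sm antipode h) * \sw_(r1, r2 <- R) act r2 a \sm r1.

Definition smash_Rmx : tensor (smash A) (smash A) :=
  \sw_(e1, e2 <- smash_comul 1) \sw_(r1, r2 <- R) \sw_(f1, f2 <- smash_comul 1)
    (e2 * (1 \sm r1) * f1) \ox (e1 * (1 \sm r2) * f2).

Hypothesis alpha_scalar : scalar alpha.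

Let cL : linear (@comul k H) := comul_linear (hopf_coalgebra (hopfP H)).
Let sL : forall h : H, linear (fun a : A => a \sm h) := (tens_bilin A H).1.
Let sR : forall a : A, linear (fun h : H => a \sm h) := (tens_bilin A H).2.

Lemma smash_comulE (a : A) (h : H) :
  smash_comul (a \sm h)
  = \sw_(x1, x2 <- x) \sw_(r1, r2 <- R) \sw_(h1, h2 <- comul h)
      ((a * act r2 x1) \sm (r1 * h1)) \ox (x2 \sm h2).
Proof.
apply: tlift_tens; split=> [g|b]; apply: tlift_linear_par => x1 x2;
  apply: tlift_linear_par => r1 r2; last by move=> e g g'; rewrite cL tlift_linear.
apply: tlift_linear_par => h1 h2 e b b'.
by rewrite mulrDl -scalerAl sL (tens_bilin _ _).1.
Qed.

Lemma smash_counitE (a : A) (h : H) :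
  smash_counit (a \sm h) = alpha a * counit h.
Proof.
have eL := counit_scalar (hopf_coalgebra (hopfP H)).
apply: (@tlift_tens _ _ _ k^o (fun a h => alpha a * counit h)).
split=> [g|b] e y z; first by rewrite alpha_scalar mulrDl -mulrA.
by rewrite eL mulrDr mulrCA.
Qed.

Lemma smash_antipodeE (a : A) (h : H) :
  smash_antipode (a \sm h)
  = (1 \sm antipode h) * \sw_(r1, r2 <- R) act r2 a \sm r1.
Proof.
apply: tlift_tens; split=> [g|b] e y z.
  rewrite scalerAr -mulrDr; congr (_ * _).
  have L : linear (fun a : A => \sw_(r1, r2 <- R) act r2 a \sm r1).
    apply: tlift_linear_par => r1 r2 c b b'.
    by rewrite (act_bilin A).2 sL.
  exact: L.
by rewrite (antipode_linear (hopfP H)) sR mulrDl scalerAl.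
Qed.

End SmashWeakHopf.

(* Main.v *)
Require Import Defs.
From mathcomp Require Import all_boot all_algebra all_field.

Set Implicit Arguments.
Unset Strict Implicit.
Unset Printing Implicit Defensive.

Import GRing.Theory.
Local Open Scope ring_scope.

(** Write L for A # H, i(h) = 1 # h, j(a) = a # 1, and T(a) = R^2.a # R^1. By
    quantum commutativity T is an anti-morphism from A to L whose image commutes
    with j(A) (tgtM, tgt_inA), so that j and T are the source and target maps of
    a bialgebroid over A. Since A is separable over k, this bialgebroid is a weak
    bialgebra: the given coproduct is
      Delta(j(a) i(h)) = (j(a) (x) 1) E (i (x) i)(Delta_H h),
      E = Delta(1) = T(x^1) (x) j(x^2),
    where E is idempotent because x is, and where E commutes with
    (i (x) i)(Delta_H h) because x is H-invariant (sep_smash_comulH). As moreover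
    Delta(T(a)) = E (1 (x) T(a)), multiplicativity and coassociativity become
    identities in the rings L (x) L and L (x) L (x) L, and E^12 commutes with E^23
    because j commutes with T. For the counit, A is an L-module by
    (a # h) |> b = a (h.b), the counit is l |-> alpha(l |> 1), and
    T(a) |> b = b a; the two weak multiplicativity axioms then follow from the
    duality of x and alpha.

    All this rests on the invariance of alpha, hence of x, under H (alpha_act,
    sw_actl). The functional alpha is symmetric, and it is the trace of the
    regular representation of A. From u h = S^2(h) u, where u acts trivially, S^2
    acts trivially on A; the cyclicity of the trace then gives
    alpha(h.a) = eps(h) alpha(a). In particular h is adjoint to S(h) with respect
    to the form alpha(ab), so that S(u) acts trivially as well. This is what makes
    the antipode send T(b) to j(b) (sw_antipode_tgt), whence
    S(j(a) T(b) i(h)) = i(S h) j(b) T(a), from which the antipode axioms follow.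

    For the R-matrix, which is E^21 R_L E with R_L = (i (x) i)(R), the point is
    that R_L E = E^21 R_L when A is transparent (R_sep_smash): both are equal to
    (T(x^1) (x) 1) R_L (1 (x) T(x^2)). The R-matrix is thus R_L E = E^21 R_L, its
    inverse is E R_L^-1 E^21, and triangularity is immediate. It intertwines
    j(a) (x) 1 with 1 (x) j(a), and 1 (x) T(a) with T(a) (x) 1 (smash_Rmx_inA,
    smash_Rmx_tgt). These two relations move E^12 and E^23 across R-matrices in
    L (x) L (x) L and reduce the hexagon identities to those of R. *)

(** * The generators of the smash product *)

Section Generators.

Variables (k : fieldType) (H : hopfAlg k) (A : modAlg H).
Implicit Types (a b : A) (h : H).

Definition inA a : smash A := a \sm 1.
Definition inH h : smash A := 1 \sm h.

(** The target map of the bialgebroid A # H over A, whose source map is [inA]: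
    an anti-morphism whose image commutes with that of [inA]. *)
Definition tgt (R : tensor H H) a : smash A :=
  \sw_(r1, r2 <- R) act r2 a \sm r1.

(** A is a left module over A # H, on which A acts by left multiplication. *)
Definition lact (l : smash A) b : A := \sw_(a, h <- l) a * act h b.

Definition inHH (t : tensor H H) : tensor (smash A) (smash A) :=
  \sw_(g, h <- t) inH g \ox inH h.

(** The coproduct of the unit of A # H. *)
Definition sep_smash (R : tensor H H) (x : tensor A A) :
    tensor (smash A) (smash A) :=
  \sw_(x1, x2 <- x) tgt R x1 \ox inA x2.

End Generators.

Arguments inH {k H} A h.
Arguments inHH {k H} A t.

(** * Multilinear calculus *)

Section LinearCalculus.

Variable k : fieldType.
Implicit Types U V : vectType k.
Implicit Types W X Y : lmodType k.
Implicit Type B : algType k.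

Lemma lin_id X : linear (fun z : X => z).
Proof. by []. Qed.

Lemma lin_comp X Y W (f : Y -> W) (g : X -> Y) :
  linear f -> linear g -> linear (fun z => f (g z)).
Proof. by move=> fL gL c x y; rewrite gL fL. Qed.

Lemma lin_add X W (f g : X -> W) :
  linear f -> linear g -> linear (fun z => f z + g z).
Proof. by move=> fL gL c x y; rewrite fL gL scalerDr addrACA. Qed.

Lemma lin_scaler X W c (g : X -> W) : linear g -> linear (fun z => c *: g z).
Proof. by move=> gL e x y; rewrite gL scalerDr !scalerA mulrC. Qed.

Lemma lin_scalel X W (g : X -> k) (w : W) :
  scalar g -> linear (fun z => g z *: w).
Proof. by move=> gL e x y; rewrite gL scalerDl scalerA. Qed.

Lemma sca_comp X Y (f : Y -> k) (g : X -> Y) :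
  scalar f -> linear g -> scalar (fun z => f (g z)).
Proof. by move=> fL gL c x y; rewrite gL fL. Qed.

Lemma lin_sca X (f : X -> k) : scalar f -> linear (f : X -> k^o).
Proof. by []. Qed.

Lemma sca_mull X (f : X -> k) c : scalar f -> scalar (fun z => f z * c).
Proof. by move=> fL e x y; rewrite fL mulrDl mulrA. Qed.

Lemma sca_mulr X (f : X -> k) c : scalar f -> scalar (fun z => c * f z).
Proof. by move=> fL e x y; rewrite fL mulrDr mulrCA. Qed.

Lemma lin_mull X B (f : X -> B) (b : B) : linear f -> linear (fun z => f z * b).
Proof. by move=> fL e x y; rewrite fL mulrDl scalerAl. Qed.

Lemma lin_mulr X B (f : X -> B) (b : B) : linear f -> linear (fun z => b * f z).
Proof. by move=> fL e x y; rewrite fL mulrDr scalerAr. Qed.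

Lemma lin_tensl X U V (f : X -> U) (v : V) :
  linear f -> linear (fun z => f z \ox v).
Proof. by move=> fL e x y; rewrite fL (tens_bilin U V).1. Qed.

Lemma lin_tensr X U V (f : X -> V) (u : U) :
  linear f -> linear (fun z => u \ox f z).
Proof. by move=> fL e x y; rewrite fL (tens_bilin U V).2. Qed.

Lemma lin_tlift_arg X U V W (E : U -> V -> W) (g : X -> tensor U V) :
  linear g -> linear (fun z => tlift E (g z)).
Proof. by move=> gL e x y; rewrite gL tlift_linear. Qed.

Lemma lin_tlift_par X U V W (E : X -> U -> V -> W) t :
  (forall a b, linear (fun z => E z a b)) ->
  linear (fun z => tlift (fun a b => E z a b) t).
Proof. exact: tlift_linear_par. Qed.

End LinearCalculus.

Section HopfCalculus.

Variables (k : fieldType) (H : hopfAlg k) (A : modAlg H).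
Variable X : lmodType k.

Lemma lin_comul (f : X -> H) : linear f -> linear (fun z => comul (f z)).
Proof.
by move=> fL e x y; rewrite fL (comul_linear (hopf_coalgebra (hopfP H))).
Qed.

Lemma lin_antipode (f : X -> H) : linear f -> linear (fun z => antipode (f z)).
Proof. by move=> fL e x y; rewrite fL (antipode_linear (hopfP H)). Qed.

Lemma sca_counit (f : X -> H) : linear f -> scalar (fun z => counit (f z)).
Proof.
by move=> fL e x y; rewrite fL (counit_scalar (hopf_coalgebra (hopfP H))).
Qed.

Lemma lin_actl (f : X -> H) (a : A) : linear f -> linear (fun z => act (f z) a).
Proof. by move=> fL e x y; rewrite fL (act_bilin A).1. Qed.

Lemma lin_actr (f : X -> A) h : linear f -> linear (fun z => act h (f z)).
Proof. by move=> fL e x y; rewrite fL (act_bilin A).2. Qed.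

Lemma lin_smel_l (f : X -> A) h : linear f -> linear (fun z => f z \sm h).
Proof. exact: lin_tensl. Qed.

Lemma lin_smel_r (f : X -> H) (a : A) : linear f -> linear (fun z => a \sm f z).
Proof. exact: lin_tensr. Qed.

End HopfCalculus.

(** Proves that an expression is linear or bilinear, by recursion on its syntax.
    Linearity hypotheses of the context are used for its variable heads, and an
    expression with values in k is treated as a scalar one. *)
Ltac lin :=
  intros; cbv beta;
  lazymatch goal with
  | |- bilin _ => split; lin
  | |- and _ _ => split; lin
  | _ => first [ assumption | solve [auto 2] | lin_core ]
  end
with lin_core :=
  match goal with
  | |- GRing.linear_for ?s ?f =>
      lazymatch f with fun _ => _ => fail | _ => idtac end;
      change (GRing.linear_for s (fun z => f z)); lin
  | |- GRing.linear_for (@GRing.scale _ _) ?f => apply: (@lin_sca _ _ f); lin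
  | |- GRing.linear_for _ (fun z => z) => exact: lin_id
  | |- GRing.linear_for _ (fun z => @tlift ?k ?U ?V ?W _ ?t) =>
      apply: (@lin_tlift_par k _ U V W); lin
  | |- GRing.linear_for _ (fun z => @tlift ?k ?U ?V ?W ?E (@?g z)) =>
      apply: (@lin_tlift_arg k _ U V W E g); lin
  | |- GRing.linear_for _ (fun z => ?b * @?g z) =>
      first [apply: (@lin_mulr _ _ _ g b); lin | apply: (@sca_mulr _ _ g b); lin]
  | |- GRing.linear_for _ (fun z => @?g z * ?b) =>
      first [apply: (@lin_mull _ _ _ g b); lin | apply: (@sca_mull _ _ g b); lin]
  | |- GRing.linear_for _ (fun z => ?b \ox @?g z) =>
      apply: (@lin_tensr _ _ _ _ g b); lin
  | |- GRing.linear_for _ (fun z => @?g z \ox ?b) =>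
      apply: (@lin_tensl _ _ _ _ g b); lin
  | |- GRing.linear_for _ (fun z => ?b \sm @?g z) =>
      apply: (@lin_smel_r _ _ _ _ g b); lin
  | |- GRing.linear_for _ (fun z => @?g z \sm ?b) =>
      apply: (@lin_smel_l _ _ _ _ g b); lin
  | |- GRing.linear_for _ (fun z => act ?b (@?g z)) =>
      apply: (@lin_actr _ _ _ _ g b); lin
  | |- GRing.linear_for _ (fun z => act (@?g z) ?b) =>
      apply: (@lin_actl _ _ _ _ g b); lin
  | |- GRing.linear_for _ (fun z => comul (@?g z)) =>
      apply: (@lin_comul _ _ _ g); lin
  | |- GRing.linear_for _ (fun z => antipode (@?g z)) =>
      apply: (@lin_antipode _ _ _ g); lin
  | |- GRing.linear_for _ (fun z => counit (@?g z)) =>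
      apply: (@sca_counit _ _ _ g); lin
  | |- GRing.linear_for _ (fun z => ?c *: @?g z) =>
      apply: (@lin_scaler _ _ _ c g); lin
  | |- GRing.linear_for _ (fun z => @?g z *: ?w) =>
      apply: (@lin_scalel _ _ _ g w); lin
  | |- GRing.linear_for _ (fun z => @?f z + @?g z) =>
      apply: (@lin_add _ _ _ f g); lin
  | L : GRing.linear_for _ ?f |- GRing.linear_for _ (fun z => ?f (@?g z)) =>
      first [apply: (@lin_comp _ _ _ _ f g L); lin
            | apply: (@sca_comp _ _ _ f g L); lin]
  | L : forall _, GRing.linear_for _ _
    |- GRing.linear_for _ (fun z => ?f (@?g z)) =>
      first [apply: (@lin_comp _ _ _ _ f g (L _)); lin
            | apply: (@sca_comp _ _ _ f g (L _)); lin]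
  | L : forall _ _, GRing.linear_for _ _
    |- GRing.linear_for _ (fun z => ?f (@?g z)) =>
      first [apply: (@lin_comp _ _ _ _ f g (L _ _)); lin
            | apply: (@sca_comp _ _ _ f g (L _ _)); lin]
  | L : forall _ _ _, GRing.linear_for _ _
    |- GRing.linear_for _ (fun z => ?f (@?g z)) =>
      first [apply: (@lin_comp _ _ _ _ f g (L _ _ _)); lin
            | apply: (@sca_comp _ _ _ f g (L _ _ _)); lin]
  | L : forall _, GRing.linear_for _ _
    |- GRing.linear_for _ (fun z => ?f (@?g z) ?b) =>
      apply: (@lin_comp _ _ _ _ (fun y => f y b) g (L b)); lin
  | |- _ =>
      progress unfold inA, inH, tgt, lact, inHH, sep_smash, leg12, leg13, leg23,
        flip, smash_comul, smash_counit, smash_antipode; lin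
  end.

(** * Calculus with Sweedler sums *)

(** An identity between tensors is used in lifted form: an arbitrary multilinear
    map F is applied to both sides, so that it can rewrite the copies of a tensor
    inside a larger expression. *)

Section Lifts.

Variable k : fieldType.
Implicit Types U V : vectType k.
Implicit Types W X Y : lmodType k.

Lemma eq_sw U V W (E F : U -> V -> W) t :
  (forall a b, E a b = F a b) -> \sw_(a, b <- t) E a b = \sw_(a, b <- t) F a b.
Proof. exact: eq_tlift. Qed.

Lemma swap_sw U V U' V' W (E : U -> V -> U' -> V' -> W) s t :
  \sw_(a, b <- s) (\sw_(c, d <- t) E a b c d)
  = \sw_(c, d <- t) (\sw_(a, b <- s) E a b c d).
Proof. exact: exchange_tlift. Qed.

Lemma sw_lin U V W W' (f : W -> W') (E : U -> V -> W) t :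
  linear f -> f (\sw_(a, b <- t) E a b) = \sw_(a, b <- t) f (E a b).
Proof. exact: linear_tlift. Qed.

Lemma sw_mull U V (B : algType k) (E : U -> V -> B) t b :
  (\sw_(u, v <- t) E u v) * b = \sw_(u, v <- t) (E u v * b).
Proof. by apply: (sw_lin (f := fun z : B => z * b)); lin. Qed.

Lemma sw_mulr U V (B : algType k) (E : U -> V -> B) t b :
  b * (\sw_(u, v <- t) E u v) = \sw_(u, v <- t) (b * E u v).
Proof. by apply: (sw_lin (f := fun z : B => b * z)); lin. Qed.

Lemma sw_mulm U V (B : algType k) (E : U -> V -> B) t b c :
  b * (\sw_(u, v <- t) E u v) * c = \sw_(u, v <- t) (b * E u v * c).
Proof. by rewrite sw_mulr sw_mull. Qed.

Lemma sw_tensl U V U' V' (E : U -> V -> U') t (b : V') :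
  (\sw_(u, v <- t) E u v) \ox b = \sw_(u, v <- t) (E u v \ox b).
Proof. by apply: (sw_lin (f := fun z => z \ox b)); lin. Qed.

Lemma sw_tensr U V U' V' (E : U -> V -> V') t (b : U') :
  b \ox (\sw_(u, v <- t) E u v) = \sw_(u, v <- t) (b \ox E u v).
Proof. by apply: (sw_lin (f := fun z => b \ox z)); lin. Qed.

Lemma sw_sw U V U' V' W (E : U -> V -> tensor U' V') (F : U' -> V' -> W) t :
  \sw_(a, b <- \sw_(u, v <- t) E u v) F a b
  = \sw_(u, v <- t) \sw_(a, b <- E u v) F a b.
Proof. by apply: (sw_lin (f := tlift F)); apply: tlift_linear. Qed.

Lemma sw_tens U V W (E : U -> V -> W) u v :
  bilin E -> \sw_(a, b <- u \ox v) E a b = E u v.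
Proof. exact: tlift_tens. Qed.

(** It suffices to test multiplicativity on pure tensors. *)
Lemma tens_hom (A B C : falgType k) (f : tensor A B -> C) :
    linear f ->
    (forall a b c d, f ((a * c) \ox (b * d)) = f (a \ox b) * f (c \ox d)) ->
  forall s t, f (s * t) = f s * f t.
Proof.
move=> fL fM s t.
have fE r : f r = \sw_(a, b <- r) f (a \ox b) by rewrite {1}(tens_sum r)
  (sw_lin _ _ fL).
rewrite (fE s) (fE t) sw_mull -[s * t]/(tens_mul s t) /tens_mul (sw_lin _ _ fL).
apply: eq_sw => a b; rewrite (sw_lin _ _ fL) sw_mulr.
by apply: eq_sw => c d.
Qed.

Lemma linZ X W (f : X -> W) c z : linear f -> f (c *: z) = c *: f z.
Proof. by move=> fL; rewrite (GRing.scalable_linear fL). Qed.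

Lemma tensZl U V c (u : U) (v : V) : (c *: u) \ox v = c *: (u \ox v).
Proof. by apply: (linZ (f := fun z => z \ox v)); lin. Qed.

Lemma tensZr U V c (u : U) (v : V) : u \ox (c *: v) = c *: (u \ox v).
Proof. by apply: (linZ (f := fun z => u \ox z)); lin. Qed.

Lemma sw_flip U V W (F : V -> U -> W) (t : tensor U V) :
  bilin F -> \sw_(a, b <- flip t) F a b = \sw_(a, b <- t) F b a.
Proof.
by move=> [F1 F2]; rewrite sw_sw; apply: eq_sw => a b; rewrite sw_tens.
Qed.

Lemma tensM (A B : falgType k) (a c : A) (b d : B) :
  (a \ox b) * (c \ox d) = (a * c) \ox (b * d).
Proof. exact: tens_mulE. Qed.

Lemma sw_mul (A B : falgType k) W (F : A -> B -> W) (s t : tensor A B) :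
  bilin F ->
  \sw_(p, q <- s * t) F p q
  = \sw_(a, b <- s) \sw_(c, d <- t) F (a * c) (b * d).
Proof.
move=> FL; rewrite -[s * t]/(tens_mul s t) /tens_mul sw_sw; apply: eq_sw => a b.
by rewrite sw_sw; apply: eq_sw => c d; rewrite sw_tens.
Qed.

Lemma sw_one (A B : falgType k) W (F : A -> B -> W) :
  bilin F -> \sw_(p, q <- (1 : tensor A B)) F p q = F 1 1.
Proof. exact: sw_tens. Qed.

End Lifts.

Definition sw_pull := (sw_mull, sw_mulr, sw_tensl, sw_tensr).

(** * Hopf algebras *)

Section HopfAlgebra.

Variables (k : fieldType) (H : hopfAlg k).
Implicit Types g h : H.
Implicit Types W : lmodType k.

Lemma sw_comulA W (F : H -> H -> H -> W) h :
    (forall b c, linear (fun a => F a b c)) ->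
    (forall a c, linear (fun b => F a b c)) ->
    (forall a b, linear (F a b)) ->
  \sw_(h1, h2 <- comul h) \sw_(h11, h12 <- comul h1) F h11 h12 h2
  = \sw_(h1, h2 <- comul h) \sw_(h21, h22 <- comul h2) F h1 h21 h22.
Proof. by move=> F1 F2 F3; apply: comul_assoc_tlift. Qed.

(** Brings the two middle factors of the fourfold coproduct into a common
    coproduct, where the antipode axioms can contract them. *)
Lemma sw_comulA4 W (F : H -> H -> H -> H -> W) h :
    (forall b c d, linear (fun a => F a b c d)) ->
    (forall a c d, linear (fun b => F a b c d)) ->
    (forall a b d, linear (fun c => F a b c d)) ->
    (forall a b c, linear (F a b c)) ->
  \sw_(h1, h2 <- comul h) \sw_(h11, h12 <- comul h1)
    \sw_(h21, h22 <- comul h2) F h11 h12 h21 h22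
  = \sw_(h1, h2 <- comul h) \sw_(h11, h12 <- comul h1)
    \sw_(h121, h122 <- comul h12) F h11 h121 h122 h2.
Proof.
move=> F1 F2 F3 F4.
transitivity (\sw_(h1, h2 <- comul h) \sw_(h21, h22 <- comul h2)
    \sw_(h11, h12 <- comul h1) F h11 h12 h21 h22).
  by apply: eq_sw => h1 h2; rewrite swap_sw.
rewrite -(sw_comulA (F := fun h1 h21 h22 =>
  \sw_(h11, h12 <- comul h1) F h11 h12 h21 h22)); try by lin.
apply: eq_sw => h1 h2.
by rewrite (sw_comulA (F := fun p q r => F p q r h2)) //; lin.
Qed.

Lemma sw_counitl W (G : H -> W) h : linear G ->
  \sw_(h1, h2 <- comul h) counit h1 *: G h2 = G h.
Proof.
move=> GL; rewrite -[in RHS](counitl (hopf_coalgebra (hopfP H)) h).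
by rewrite (sw_lin _ _ GL); apply: eq_sw => a b; rewrite (linZ _ _ GL).
Qed.

Lemma sw_counitr W (G : H -> W) h : linear G ->
  \sw_(h1, h2 <- comul h) counit h2 *: G h1 = G h.
Proof.
move=> GL; rewrite -[in RHS](counitr (hopf_coalgebra (hopfP H)) h).
by rewrite (sw_lin _ _ GL); apply: eq_sw => a b; rewrite (linZ _ _ GL).
Qed.

Lemma sw_antipodel W (G : H -> W) h : linear G ->
  \sw_(h1, h2 <- comul h) G (antipode h1 * h2) = counit h *: G 1.
Proof.
move=> GL; rewrite -(linZ _ _ GL) -(antipodel (hopfP H)).
by rewrite (sw_lin _ _ GL).
Qed.

Lemma sw_antipoder W (G : H -> W) h : linear G ->
  \sw_(h1, h2 <- comul h) G (h1 * antipode h2) = counit h *: G 1.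
Proof.
move=> GL; rewrite -(linZ _ _ GL) -(antipoder (hopfP H)).
by rewrite (sw_lin _ _ GL).
Qed.

Lemma sw_comulM W (F : H -> H -> W) g h : bilin F ->
  \sw_(p, q <- comul (g * h)) F p q
  = \sw_(g1, g2 <- comul g) \sw_(h1, h2 <- comul h) F (g1 * h1) (g2 * h2).
Proof. by move=> FL; rewrite (comulM (hopfP H)) sw_mul. Qed.

Lemma sw_comul1 W (F : H -> H -> W) : bilin F ->
  \sw_(p, q <- comul (1 : H)) F p q = F 1 1.
Proof. by move=> FL; rewrite (comul1 (hopfP H)) sw_one. Qed.

Lemma antipode1 : antipode (1 : H) = 1.
Proof.
have := antipodel (hopfP H) 1; rewrite sw_comul1; last by lin.
by rewrite mulr1 (counit1 (hopfP H)) scale1r.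
Qed.

(** S(gh) = S(g_1 h_1) g_2 h_2 S(h_3) S(g_3) = S(h) S(g): the two sides are a
    left and a right convolution inverse of the multiplication of H. *)
Lemma antipodeM g h : antipode (g * h) = antipode h * antipode g.
Proof.
have inner g1 h1 g2 h2 : \sw_(g11, g12 <- comul g1) \sw_(h11, h12 <- comul h1)
      antipode (g11 * h11) * (g12 * (h12 * antipode h2) * antipode g2)
    = counit g1 *: (counit h1 *: (antipode h2 * antipode g2)).
  rewrite scalerA -(counitM (hopfP H)) -[X in _ *: X]mul1r.
  rewrite -(sw_antipodel (G := fun z => z * _)); last by lin.
  rewrite sw_comulM; last by lin.
  by apply: eq_sw => g11 g12; apply: eq_sw => h11 h12; rewrite !mulrA.
transitivity (\sw_(g1, g2 <- comul g) \sw_(g21, g22 <- comul g2)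
  \sw_(h1, h2 <- comul h) \sw_(h21, h22 <- comul h2)
   antipode (g1 * h1) * (g21 * (h21 * antipode h22) * antipode g22)).
  under eq_sw => g1 g2.
    under eq_sw => g21 g22.
      under eq_sw => h1 h2.
        rewrite (sw_antipoder (G := fun z => _ * (_ * z * _))); last by lin.
        rewrite mulr1. over.
      rewrite (sw_counitr (G := fun z => antipode (g1 * z) * _)); last by lin.
      over.
    rewrite (sw_antipoder (G := fun z => _ * z)); last by lin.
    rewrite mulr1. over.
  by rewrite (sw_counitr (G := fun z => antipode (z * _))) //; lin.
rewrite -(sw_comulA (F := fun g1 g21 g22 => \sw_(h1, h2 <- comul h)
   \sw_(h21, h22 <- comul h2)
   antipode (g1 * h1) * (g21 * (h21 * antipode h22) * antipode g22))); try lin.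
under eq_sw => g1 g2.
  under eq_sw => g11 g12.
    rewrite -(sw_comulA (F := fun h1 h21 h22 => antipode (g11 * h1) *
      (g12 * (h21 * antipode h22) * antipode g2))); try lin.
    over.
  rewrite swap_sw.
  under eq_sw => h1 h2.
    rewrite inner. over.
  rewrite -(sw_lin (f := fun z => counit g1 *: z)); last by lin.
  rewrite (sw_counitl (G := fun z => antipode z * _)); last by lin.
  over.
by rewrite (sw_counitl (G := fun z => _ * antipode z)) //; lin.
Qed.

End HopfAlgebra.

(** * The universal R-matrix *)

Section RMatrix.

Variables (k : fieldType) (H : hopfAlg k) (R : tensor H H).
Hypothesis qtR : quasitriangular R.
Implicit Types g h : H.
Implicit Types W : lmodType k.

Lemma sw_hexl W (F : H -> H -> H -> W) :
    (forall b c, linear (fun a => F a b c)) ->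
    (forall a c, linear (fun b => F a b c)) ->
    (forall a b, linear (F a b)) ->
  \sw_(r1, r2 <- R) \sw_(a, b <- comul r1) F a b r2
  = \sw_(r11, r12 <- R) \sw_(r21, r22 <- R) F r11 r21 (r12 * r22).
Proof.
move=> F1 F2 F3.
pose G (t : tensor H H) c := \sw_(a, b <- t) F a b c.
have GL : bilin G by rewrite /G; split=> *; [apply: tlift_linear | lin].
have := congr1 (tlift G) (qt_comull qtR); rewrite !sw_sw => E.
transitivity (\sw_(r1, r2 <- R) tlift G (comul r1 \ox r2)).
  by apply: eq_sw => a b; rewrite sw_tens.
rewrite E; apply: eq_sw => a b; rewrite sw_sw; apply: eq_sw => c d.
by rewrite sw_tens // /G sw_tens.
Qed.

Lemma sw_hexr W (F : H -> H -> H -> W) :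
    (forall b c, linear (fun a => F a b c)) ->
    (forall a c, linear (fun b => F a b c)) ->
    (forall a b, linear (F a b)) ->
  \sw_(r1, r2 <- R) \sw_(a, b <- comul r2) F r1 a b
  = \sw_(r11, r12 <- R) \sw_(r21, r22 <- R) F (r11 * r21) r22 r12.
Proof.
move=> F1 F2 F3.
pose G (t : tensor H H) c := \sw_(a, b <- t) F a b c.
have GL : bilin G by rewrite /G; split=> *; [apply: tlift_linear | lin].
have := congr1 (tlift G) (qt_comulr qtR); rewrite !sw_sw => E.
transitivity (\sw_(r1, r2 <- R) tlift G (\sw_(a, b <- comul r2) r1 \ox a \ox b)).
  apply: eq_sw => a b; rewrite sw_sw; apply: eq_sw => c d.
  by rewrite sw_tens // /G sw_tens.
rewrite E; apply: eq_sw => a b; rewrite sw_sw; apply: eq_sw => c d.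
by rewrite sw_tens // /G sw_tens.
Qed.

Lemma sw_qtC W (F : H -> H -> W) h : bilin F ->
  \sw_(r1, r2 <- R) \sw_(h1, h2 <- comul h) F (r1 * h1) (r2 * h2)
  = \sw_(h1, h2 <- comul h) \sw_(r1, r2 <- R) F (h2 * r1) (h1 * r2).
Proof.
move=> FL; have := congr1 (tlift F) (qt_comulC qtR h).
case: (FL) => F1 F2; rewrite !sw_mul // sw_flip //; lin.
Qed.

(** Applying the counit to the first leg of a hexagon identity gives
    R = (1 (x) q) R, and R can be cancelled. *)
Lemma counitR1 : \sw_(r1, r2 <- R) counit r1 *: r2 = 1.
Proof.
set q := (X in X = 1).
have qR : (1 \ox q) * R = R.
  rewrite [in RHS](tens_sum R).
  transitivity (\sw_(r1, r2 <- R) \sw_(a, b <- comul r1) counit a *: (b \ox r2)).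
    rewrite sw_hexl; try by lin.
    rewrite {1}(tens_sum R) /q !sw_pull; apply: eq_sw => a b.
    rewrite sw_mulr; apply: eq_sw => c d; rewrite tensM mul1r.
    by rewrite -scalerAl tensZr.
  by apply: eq_sw => a b; rewrite (sw_counitl (G := fun z => z \ox b)) //; lin.
have q1 : 1 \ox q = 1 \ox 1 :> tensor H H
  by rewrite -[LHS](mulrK (qt_unit qtR)) qR mulrV ?qt_unit.
have := congr1 (tlift (fun a b : H => counit a *: b)) q1.
by rewrite !sw_tens ?(counit1 (hopfP H)) ?scale1r //; lin.
Qed.

Lemma counitR2 : \sw_(r1, r2 <- R) counit r2 *: r1 = 1.
Proof.
set q := (X in X = 1).
have qR : (q \ox 1) * R = R.
  rewrite [in RHS](tens_sum R).
  transitivity (\sw_(r1, r2 <- R) \sw_(a, b <- comul r2) counit b *: (r1 \ox a)).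
    rewrite sw_hexr; try by lin.
    rewrite {1}(tens_sum R) /q !sw_pull; apply: eq_sw => a b.
    rewrite sw_mulr; apply: eq_sw => c d; rewrite tensM mul1r.
    by rewrite -scalerAl tensZl.
  by apply: eq_sw => a b; rewrite (sw_counitr (G := fun z => a \ox z)) //; lin.
have q1 : q \ox 1 = 1 \ox 1 :> tensor H H
  by rewrite -[LHS](mulrK (qt_unit qtR)) qR mulrV ?qt_unit.
have := congr1 (tlift (fun a b : H => counit b *: a)) q1.
by rewrite !sw_tens ?(counit1 (hopfP H)) ?scale1r //; lin.
Qed.

Lemma sw_counitR1 W (G : H -> W) : linear G ->
  \sw_(r1, r2 <- R) counit r1 *: G r2 = G 1.
Proof.
move=> GL; rewrite -counitR1 (sw_lin _ _ GL); apply: eq_sw => a b.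
by rewrite (linZ _ _ GL).
Qed.

Lemma sw_counitR2 W (G : H -> W) : linear G ->
  \sw_(r1, r2 <- R) counit r2 *: G r1 = G 1.
Proof.
move=> GL; rewrite -counitR2 (sw_lin _ _ GL); apply: eq_sw => a b.
by rewrite (linZ _ _ GL).
Qed.

Lemma sw_R_invr W (F : H -> H -> W) : bilin F ->
  \sw_(r11, r12 <- R) \sw_(r21, r22 <- R) F (r11 * antipode r21) (r12 * r22)
  = F 1 1.
Proof.
move=> FL; have [F1 F2] := FL.
rewrite -(sw_hexl (F := fun a b c => F (a * antipode b) c)); try by lin.
under eq_sw => a b do rewrite (sw_antipoder (G := F^~ b)) //.
exact: (sw_counitR1 (G := F 1)).
Qed.

Lemma sw_R_invl W (F : H -> H -> W) : bilin F ->
  \sw_(r11, r12 <- R) \sw_(r21, r22 <- R) F (antipode r11 * r21) (r12 * r22)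
  = F 1 1.
Proof.
move=> FL; have [F1 F2] := FL.
rewrite -(sw_hexl (F := fun a b c => F (antipode a * b) c)); try by lin.
under eq_sw => a b do rewrite (sw_antipodel (G := F^~ b)) //.
exact: (sw_counitR1 (G := F 1)).
Qed.

(** This is R^1 (x) S(R^2) being inverse to R in the tensor product of H and of
    the opposite algebra of H. *)
Lemma sw_Rop_inv W (F : H -> H -> W) : bilin F ->
  \sw_(r11, r12 <- R) \sw_(r21, r22 <- R) F (r11 * r21) (r22 * antipode r12)
  = F 1 1.
Proof.
move=> FL; have [F1 F2] := FL.
rewrite -(sw_hexr (F := fun a b c => F a (b * antipode c))); try by lin.
under eq_sw => a b do rewrite (sw_antipoder (G := F a)) //.
exact: (sw_counitR2 (G := F^~ 1)).
Qed.

(** The commutation of R with the coproduct gives S(h_2) u h_1 = eps(h) u. Hence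
    u h = S^2(h_3) S(h_2) u h_1 = S^2(h) u. *)
Lemma drinfeld_conj h : antipode (antipode h) * drinfeld R = drinfeld R * h.
Proof.
have uh : \sw_(h1, h2 <- comul h) \sw_(a, b <- comul h2)
   antipode (antipode b) * (antipode a * drinfeld R * h1) = drinfeld R * h.
  transitivity (\sw_(h1, h2 <- comul h) counit h2 *: (drinfeld R * h1)).
    apply: eq_sw => h1 h2.
    transitivity (\sw_(a, b <- comul h2) antipode (a * antipode b) * (drinfeld R * h1)).
      by apply: eq_sw => a b; rewrite antipodeM !mulrA.
    rewrite (sw_antipoder (G := fun z => antipode z * (drinfeld R * h1)));
      last by lin.
    by rewrite antipode1 mul1r.
  by rewrite (sw_counitr (G := fun z => drinfeld R * z)) //; lin.
rewrite -uh -(sw_comulA (F := fun h1 a b => antipode (antipode b) *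
   (antipode a * drinfeld R * h1))); try by lin.
transitivity (\sw_(h1, h2 <- comul h)
    counit h1 *: (antipode (antipode h2) * drinfeld R)).
  by rewrite (sw_counitl (G := fun z => antipode (antipode z) * drinfeld R)) //;
    lin.
apply: eq_sw => h1 h2; rewrite -sw_mulr scalerAr; congr (_ * _).
rewrite /drinfeld; symmetry.
transitivity (\sw_(a, b <- comul h1) \sw_(r1, r2 <- R) antipode (r2 * b) * (r1 * a)).
  apply: eq_sw => a b; rewrite !sw_pull.
  by apply: eq_sw => r1 r2; rewrite antipodeM !mulrA.
rewrite swap_sw (sw_qtC (F := fun p q => antipode q * p)); last by lin.
rewrite swap_sw.
under eq_sw => r1 r2.
  under eq_sw => a b do rewrite antipodeM -mulrA (mulrA (antipode a)).
  rewrite (sw_antipodel (G := fun z => antipode r2 * (z * r1))); last by lin.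
  rewrite mul1r. over.
by rewrite -(sw_lin (f := fun z => counit h1 *: z)) //; lin.
Qed.

End RMatrix.

(** * Symmetric separability idempotents *)

Section SymmetricSeparability.

Variables (k : fieldType) (B : falgType k) (x : tensor B B) (alpha : B -> k).
Hypothesis sepx : symmetric_separability_idempotent x.
Hypothesis alphaL : scalar alpha.
Hypothesis alphax : \sw_(x1, x2 <- x) alpha x1 *: x2 = 1.
Implicit Types a b c : B.
Implicit Types W : lmodType k.

Lemma sw_sym W (F : B -> B -> W) : bilin F ->
  \sw_(x1, x2 <- x) F x1 x2 = \sw_(x1, x2 <- x) F x2 x1.
Proof. by move=> FL; case: sepx => _ _ {1}<-; rewrite sw_flip. Qed.

Lemma sw_sepl W (F : B -> B -> W) b : bilin F ->
  \sw_(x1, x2 <- x) F (b * x1) x2 = \sw_(x1, x2 <- x) F x1 (x2 * b).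
Proof.
move=> FL; have [/(_ b) E _ _] := sepx; have := congr1 (tlift F) E.
by rewrite !sw_sw; under eq_sw do rewrite sw_tens //;
  under [RHS]eq_sw do rewrite sw_tens //.
Qed.

Lemma sw_sepr W (F : B -> B -> W) b : bilin F ->
  \sw_(x1, x2 <- x) F (x1 * b) x2 = \sw_(x1, x2 <- x) F x1 (b * x2).
Proof.
move=> [F1 F2]; rewrite (sw_sym (F := fun p q => F (p * b) q)); last by lin.
rewrite (sw_sym (F := fun p q => F p (b * q))); last by lin.
by rewrite (sw_sepl (F := fun p q => F q p)) //; lin.
Qed.

Lemma sw_sep1 W (G : B -> W) : linear G -> \sw_(x1, x2 <- x) G (x1 * x2) = G 1.
Proof. by move=> GL; have [_ <- _] := sepx; rewrite (sw_lin _ _ GL). Qed.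

Lemma sw_sep1C W (G : B -> W) : linear G -> \sw_(x1, x2 <- x) G (x2 * x1) = G 1.
Proof.
by move=> GL; rewrite (sw_sym (F := fun p q => G (q * p))); [exact: sw_sep1|lin].
Qed.

Let sw_alpha1 W (G : B -> W) : linear G -> \sw_(x1, x2 <- x) alpha x1 *: G x2
  = G 1.
Proof.
move=> GL; rewrite -alphax (sw_lin _ _ GL); apply: eq_sw => a b.
by rewrite (linZ _ _ GL).
Qed.

(** Duality of x and of the form alpha(ab). It holds with the variable on either
    side of either leg (sw_frobCl, sw_frobr, sw_frobCr). *)
Lemma sw_frobl W (G : B -> W) a : linear G ->
  \sw_(x1, x2 <- x) alpha (x1 * a) *: G x2 = G a.
Proof.
move=> GL; rewrite (sw_sepr (F := fun p q => alpha p *: G q)); last by lin.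
by rewrite (sw_alpha1 (G := fun z => G (a * z))) ?mulr1 //; lin.
Qed.

Lemma sw_frobCl W (G : B -> W) a : linear G ->
  \sw_(x1, x2 <- x) alpha (a * x1) *: G x2 = G a.
Proof.
move=> GL; rewrite (sw_sepl (F := fun p q => alpha p *: G q)); last by lin.
by rewrite (sw_alpha1 (G := fun z => G (z * a))) ?mul1r //; lin.
Qed.

(** Both products expand as the pairing of a and b with x, and x is symmetric. *)
Lemma alphaC a b : alpha (a * b) = alpha (b * a).
Proof.
transitivity (\sw_(x1, x2 <- x) (alpha (x1 * a) * alpha (x2 * b) : k^o)).
  by symmetry; apply: (sw_frobl (W := k^o) (G := fun z => alpha (z * b))); lin.
rewrite (sw_sym (F := fun p q => alpha (p * a) * alpha (q * b) : k^o));
  last by lin.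
transitivity (\sw_(x1, x2 <- x) (alpha (x1 * b) * alpha (x2 * a) : k^o)).
  by apply: (eq_sw (W := k^o)) => p q; rewrite mulrC.
by apply: (sw_frobl (W := k^o) (G := fun z => alpha (z * a))); lin.
Qed.

Lemma sw_frobr W (G : B -> W) a : linear G ->
  \sw_(x1, x2 <- x) alpha (x2 * a) *: G x1 = G a.
Proof.
move=> GL; rewrite -(sw_sym (F := fun p q => alpha (p * a) *: G q)) ?sw_frobl //.
by lin.
Qed.

Lemma sw_frobCr W (G : B -> W) a : linear G ->
  \sw_(x1, x2 <- x) alpha (a * x2) *: G x1 = G a.
Proof.
by move=> GL; under eq_sw do rewrite alphaC; apply: sw_frobr.
Qed.

(** The trace of f, as x^1 and alpha(x^2 -) are dual bases of B. *)
Definition sep_trace (f : B -> B) : k :=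
  \sw_(x1, x2 <- x) (alpha (x2 * f x1) : k^o).

Lemma sep_traceC (f g : B -> B) : linear f -> linear g ->
  sep_trace (f \o g) = sep_trace (g \o f).
Proof.
have expand (p q : B -> B) : linear p -> linear q -> sep_trace (p \o q)
    = \sw_(x1, x2 <- x) \sw_(y1, y2 <- x)
        (alpha (y2 * q x1) * alpha (x2 * p y1) : k^o).
  move=> pL qL; apply: (eq_sw (W := k^o)) => x1 x2.
  by symmetry; apply: (sw_frobr (W := k^o) (G := fun z => alpha (x2 * p z))); lin.
move=> fL gL; rewrite !expand // swap_sw.
apply: (eq_sw (W := k^o)) => x1 x2; apply: (eq_sw (W := k^o)) => y1 y2.
by rewrite mulrC.
Qed.

Lemma sep_trace_mul a : sep_trace ( *%R a) = alpha a.
Proof.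
transitivity (\sw_(x1, x2 <- x) (alpha (a * (x1 * x2)) : k^o)).
  by apply: (eq_sw (W := k^o)) => p q; rewrite alphaC mulrA.
rewrite (sw_sep1 (W := k^o) (G := fun z => alpha (a * z))) ?mulr1 //; lin.
Qed.

Lemma alpha_nondeg a b : (forall c, alpha (c * a) = alpha (c * b)) -> a = b.
Proof.
move=> E; rewrite -[LHS](sw_frobl (G := id)) // -[RHS](sw_frobl (G := id)) //.
by apply: eq_sw => p q; rewrite E.
Qed.

End SymmetricSeparability.

(** * Invariance of the trace form *)

Section InvariantTrace.

Variables (k : fieldType) (H : hopfAlg k) (R : tensor H H).
Hypothesis qtR : quasitriangular R.
Variables (A : modAlg H) (x : tensor A A) (alpha : A -> k).
Hypothesis sepx : symmetric_separability_idempotent x.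
Hypothesis alphaL : scalar alpha.
Hypothesis alphax : \sw_(x1, x2 <- x) alpha x1 *: x2 = 1.
Hypothesis u_trivial : forall a : A, act (drinfeld R) a = a.
Implicit Types a b c : A.
Implicit Types h : H.
Implicit Types W : lmodType k.

(** S^2(h).a = S^2(h) u.a = u h.a = h.a *)
Lemma act_antipode2 h a : act (antipode (antipode h)) a = act h a.
Proof.
by rewrite -[in LHS](u_trivial a) -act_comp (drinfeld_conj qtR) act_comp u_trivial.
Qed.

(** The antipode axiom of the opposite algebra, which holds on A because S and
    its inverse have the same action. *)
Lemma sw_act_cancel W (G : A -> W) h a : linear G ->
  \sw_(h1, h2 <- comul h) G (act (antipode h2 * h1) a) = counit h *: G a.
Proof.
move=> GL; transitivity (\sw_(h1, h2 <- comul h)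
    G (act (antipode (antipode h1 * h2)) a)).
  by apply: eq_sw => p q; rewrite antipodeM !act_comp act_antipode2.
rewrite (sw_antipodel (G := fun z => G (act (antipode z) a))); last by lin.
by rewrite antipode1 act_id.
Qed.

Lemma act_mull h a b :
  act h a * b = \sw_(h1, h2 <- comul h) act h1 (a * act (antipode h2) b).
Proof.
under eq_sw do rewrite act_mul.
rewrite (sw_comulA (F := fun p q r => act p a * act q (act (antipode r) b)));
  try by lin.
under eq_sw => h1 h2.
  under eq_sw do rewrite -act_comp.
  rewrite (sw_antipoder (G := fun z => act h1 a * act z b)) ?act_id; last by lin.
  over.
by rewrite (sw_counitr (G := fun z => act z a * b)) //; lin.
Qed.

(** Multiplication by h.a is h_1 o (multiplication by a) o S(h_2); the trace moves
    h_1 to the right, where it cancels with S(h_2). *)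
Lemma alpha_act h a : alpha (act h a) = counit h * alpha a.
Proof.
rewrite -(sep_trace_mul sepx alphaL alphax (act h a)).
transitivity (\sw_(h1, h2 <- comul h)
    (sep_trace x alpha (act h1 \o (fun z => a * act (antipode h2) z)) : k^o)).
  rewrite swap_sw; apply: (eq_sw (W := k^o)) => x1 x2; rewrite act_mull.
  by apply: (sw_lin (W' := k^o) (f := fun z => alpha (x2 * z))); lin.
transitivity (\sw_(h1, h2 <- comul h)
    (sep_trace x alpha ((fun z => a * act (antipode h2) z) \o act h1) : k^o)).
  by apply: (eq_sw (W := k^o)) => h1 h2;
    rewrite (sep_traceC sepx alphaL alphax) //; lin.
rewrite swap_sw.
transitivity (\sw_(x1, x2 <- x) (counit h * alpha (x2 * (a * x1)) : k^o));
  last first.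
  rewrite -(sep_trace_mul sepx alphaL alphax a); symmetry.
  by apply: (sw_lin (W := k^o) (W' := k^o) (f := fun z : k^o => counit h * z));
    lin.
apply: (eq_sw (W := k^o)) => x1 x2 /=;
  under (eq_sw (W := k^o)) do rewrite -act_comp.
by apply: (sw_act_cancel (W := k^o) (G := fun z => alpha (x2 * (a * z)))); lin.
Qed.

Lemma alpha_adj h a b : alpha (act h a * b) = alpha (a * act (antipode h) b).
Proof.
rewrite act_mull (sw_lin (W' := k^o) (f := alpha)) //.
under (eq_sw (W := k^o)) do rewrite alpha_act.
by apply: (sw_counitl (W := k^o) (G := fun z => alpha (a * act (antipode z) b)));
  lin.
Qed.

Lemma alpha_adjS h a b : alpha (act (antipode h) a * b) = alpha (a * act h b).
Proof. by rewrite alpha_adj act_antipode2. Qed.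

(** Invariance of x. The element x is dual to the form alpha(ab), for which h and
    S(h) are adjoint. *)
Lemma sw_actl W (F : A -> A -> W) h : bilin F ->
  \sw_(x1, x2 <- x) F (act h x1) x2
    = \sw_(x1, x2 <- x) F x1 (act (antipode h) x2).
Proof.
move=> FL; have [F1 F2] := FL.
transitivity (\sw_(x1, x2 <- x) \sw_(y1, y2 <- x)
    alpha (y1 * act h x1) *: F y2 x2).
  by apply: eq_sw => x1 x2; rewrite (sw_frobl sepx alphaL alphax (G := F^~ x2)).
rewrite swap_sw (sw_sym sepx (F := fun p q => F p (act (antipode h) q)));
  last by lin.
apply: eq_sw => y1 y2; rewrite -(sw_frobl sepx alphaL alphax (G := F y2)) //.
by apply: eq_sw => x1 x2; rewrite -alpha_adjS (alphaC sepx alphaL alphax).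
Qed.

Lemma sw_actr W (F : A -> A -> W) h : bilin F ->
  \sw_(x1, x2 <- x) F x1 (act h x2)
    = \sw_(x1, x2 <- x) F (act (antipode h) x1) x2.
Proof.
move=> [F1 F2]; rewrite (sw_actl (F := F)) //.
by apply: eq_sw => x1 x2; rewrite act_antipode2.
Qed.

(** On A, S(R^1) R^2 acts as S(R^1) S^2(R^2) = S(u), and S(u) is adjoint to u. *)
Lemma act_antipode_drinfeld W (G : A -> W) a : linear G ->
  \sw_(r1, r2 <- R) G (act (antipode r1 * r2) a) = G a.
Proof.
move=> GL; rewrite -(sw_lin (f := G)) //; congr (G _).
transitivity (act (antipode (drinfeld R)) a).
  rewrite /drinfeld (sw_lin (f := fun z => act (antipode z) a)); last by lin.
  by apply: eq_sw => p q; rewrite antipodeM !act_comp act_antipode2.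
by apply: (alpha_nondeg sepx alphaL alphax) => c; rewrite -alpha_adj u_trivial.
Qed.

Section Mueger.

Hypothesis muegerA : in_mueger_center A R.

Lemma sw_mueger W (F : A -> H -> W) a : bilin F ->
  \sw_(r11, r12 <- R) \sw_(r21, r22 <- R) F (act (r22 * r11) a) (r21 * r12)
  = F a 1.
Proof.
move=> FL; have := congr1 (tlift F) (muegerA a); rewrite sw_sw sw_tens // => <-.
by apply: eq_sw => p q; rewrite sw_sw; apply: eq_sw => r s; rewrite sw_tens.
Qed.

(** As R^21 R acts trivially on A through its first leg, the inverse
    S(R^1) (x) R^2 of R acts as R^21. *)
Lemma mueger_inv W (F : A -> H -> W) a : bilin F ->
  \sw_(r1, r2 <- R) F (act (antipode r1) a) r2
    = \sw_(r1, r2 <- R) F (act r2 a) r1.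
Proof.
move=> FL; have [F1 F2] := FL.
transitivity (\sw_(r31, r32 <- R) \sw_(r11, r12 <- R) \sw_(r21, r22 <- R)
    F (act (r22 * r11) (act (antipode r31) a)) (r21 * r12 * r32)).
  apply: eq_sw => p q.
  by rewrite (sw_mueger (F := fun c g => F c (g * q))) ?mul1r //; lin.
(* Bring together the first and the third copy, which are inverse to each other. *)
rewrite swap_sw; under eq_sw do rewrite swap_sw.
rewrite swap_sw; apply: eq_sw => p q.
transitivity (\sw_(r11, r12 <- R) \sw_(r31, r32 <- R)
    F (act (q * (r11 * antipode r31)) a) (p * (r12 * r32))).
  by do 2!apply: eq_sw => * ; rewrite -act_comp !mulrA.
by rewrite (sw_R_invr qtR (F := fun s t => F (act (q * s) a) (p * t))) ?mulr1 //;
  lin.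
Qed.

(** Likewise R acts as the inverse of R^21, which is R^2 (x) S(R^1). *)
Lemma mueger_flip W (F : A -> H -> W) a : bilin F ->
  \sw_(r1, r2 <- R) F (act r1 a) r2
    = \sw_(r1, r2 <- R) F (act r2 a) (antipode r1).
Proof.
move=> FL; have [F1 F2] := FL; symmetry.
transitivity (\sw_(r31, r32 <- R) \sw_(r11, r12 <- R) \sw_(r21, r22 <- R)
    F (act r32 (act (r22 * r11) a)) (antipode r31 * (r21 * r12))).
  apply: eq_sw => p q.
  by rewrite (sw_mueger
    (F := fun c g => F (act q c) (antipode p * g))) ?mulr1 //; lin.
rewrite swap_sw; apply: eq_sw => p q.
transitivity (\sw_(r11, r12 <- R) \sw_(r31, r32 <- R)
    F (act (r12 * r32 * p) a) (antipode r11 * r31 * q)).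
  by do 2!apply: eq_sw => * ; rewrite -act_comp !mulrA.
by rewrite (sw_R_invl qtR (F := fun s t => F (act (t * p) a) (s * q))) ?mul1r //;
  lin.
Qed.

(** Transparency turns R^2 S(R^1) into R^1 R^2 and then into S(R^2) R^1 = u. *)
Lemma mueger_R2S W (G : A -> W) a : linear G ->
  \sw_(r1, r2 <- R) G (act (r2 * antipode r1) a) = G a.
Proof.
move=> GL; rewrite -(sw_lin (f := G)) //; congr (G _).
transitivity (\sw_(r1, r2 <- R) act r2 (act (antipode r1) a)).
  by apply: eq_sw => p q; rewrite act_comp.
rewrite (mueger_inv (F := fun c g => act g c)); last by lin.
transitivity (\sw_(r1, r2 <- R) act (antipode (antipode r1)) (act r2 a)).
  by apply: eq_sw => p q; rewrite act_antipode2.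
rewrite -(mueger_flip (F := fun c g => act (antipode g) c)); last by lin.
rewrite -[RHS]u_trivial /drinfeld (sw_lin (f := fun z => act z a)); last by lin.
by apply: eq_sw => p q; rewrite act_comp.
Qed.

End Mueger.

End InvariantTrace.

(** * The smash product as a bialgebroid *)

Section SmashAlgebraTheory.

Variables (k : fieldType) (H : hopfAlg k) (A : modAlg H).
Implicit Types a b : A.
Implicit Types g h : H.
Implicit Types W : lmodType k.

Lemma smelM a b h g : (a \sm h) * (b \sm g)
  = \sw_(h1, h2 <- comul h) (a * act h1 b) \sm (h2 * g).
Proof. exact: smash_mulE. Qed.

Lemma smelE a h : a \sm h = inA a * inH A h.
Proof.
rewrite smelM (sw_comul1 (F := fun p q => (a * act p 1) \sm (q * h)));
  last by lin.
by rewrite act_id mulr1 mul1r.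
Qed.

Lemma inA1 : inA (1 : A) = 1. Proof. by []. Qed.
Lemma inH1 : inH A 1 = 1. Proof. by []. Qed.

Lemma inAM a b : inA (a * b) = inA a * inA b.
Proof.
rewrite smelM (sw_comul1 (F := fun p q => (a * act p b) \sm (q * 1)));
  last by lin.
by rewrite act_id mulr1.
Qed.

Lemma inH_inA h a :
  inH A h * inA a = \sw_(h1, h2 <- comul h) inA (act h1 a) * inH A h2.
Proof. by rewrite smelM; apply: eq_sw => p q; rewrite mul1r mulr1 smelE. Qed.

Lemma inHM g h : inH A (g * h) = inH A g * inH A h.
Proof.
rewrite smelM -(sw_counitl (G := fun z => inH A (z * h))); last by lin.
apply: eq_sw => p q; rewrite act_one mul1r /inH /smel.
by rewrite -[RHS]/((counit p *: 1) \ox _) tensZl.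
Qed.

Lemma smash_gen (P : smash A -> Prop) :
    P 0 -> (forall s t, P s -> P t -> P (s + t)) ->
  (forall a h, P (inA a * inH A h)) -> forall t, P t.
Proof. by move=> P0 PD PG; apply: smash_ind => // a h; rewrite smelE. Qed.

Lemma lact_sm a h b : lact (a \sm h) b = a * act h b.
Proof. by apply: sw_tens; lin. Qed.

Lemma lact_inA a b : lact (inA a) b = a * b.
Proof. by rewrite lact_sm act_id. Qed.

Lemma lact_inH h b : lact (inH A h) b = act h b.
Proof. by rewrite lact_sm mul1r. Qed.

Lemma lactM (l m : smash A) b : lact (l * m) b = lact l (lact m b).
Proof.
have lL (z : A) : linear (fun s : smash A => lact s z) by lin.
have rL (s : smash A) : linear (lact s) by lin.
have l0 (z : A) : lact (0 : smash A) z = 0.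
  by have := linZ 0 (0 : smash A) (lL z); rewrite !scale0r.
have lD (z : A) (s t : smash A) : lact (s + t) z = lact s z + lact t z.
  by have := lL z 1 s t; rewrite !scale1r.
have r0 (s : smash A) : lact s 0 = 0.
  by have := linZ 0 0 (rL s); rewrite !scale0r.
have rD (s : smash A) (z w : A) : lact s (z + w) = lact s z + lact s w.
  by have := rL s 1 z w; rewrite !scale1r.
elim/smash_ind: l => [|s t IHs IHt|a h]; first by rewrite mul0r !l0.
  by rewrite mulrDl !lD IHs IHt.
elim/smash_ind: m => [|s t IHs IHt|c g]; first by rewrite mulr0 !l0 r0.
  by rewrite mulrDr !lD rD IHs IHt.
rewrite smelM (sw_lin (f := fun s : smash A => lact s b)) // !lact_sm act_mul
  sw_mulr.
by apply: eq_sw => p q; rewrite lact_sm act_comp mulrA.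
Qed.

Section Target.

Variable R : tensor H H.
Hypothesis qtR : quasitriangular R.
Local Notation T := (@tgt k H A R).

Lemma tgtE a : T a = \sw_(r1, r2 <- R) inA (act r2 a) * inH A r1.
Proof. by apply: eq_sw => p q; rewrite smelE. Qed.

Lemma inH_tgt h a : inH A h * T a
  = \sw_(h1, h2 <- comul h) T (act h2 a) * inH A h1.
Proof.
transitivity (\sw_(h1, h2 <- comul h) \sw_(r1, r2 <- R)
   inA (act (h1 * r2) a) * inH A (h2 * r1)).
  rewrite tgtE sw_mulr swap_sw; apply: eq_sw => p q.
  rewrite mulrA inH_inA sw_mull; apply: eq_sw => r s.
  by rewrite -mulrA inHM act_comp.
rewrite -(sw_qtC qtR (F := fun p q => inA (act q a) * inH A p)); last by lin.
rewrite swap_sw; apply: eq_sw => p q; rewrite tgtE sw_mull; apply: eq_sw => r s.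
by rewrite -mulrA -inHM act_comp.
Qed.

Lemma tgt1 : T 1 = 1.
Proof.
rewrite tgtE -inH1 -(sw_counitR2 qtR (G := inH A)); last by lin.
apply: eq_sw => p q; rewrite act_one (linZ (f := @inA k H A)); last by lin.
by rewrite -scalerAl inA1 mul1r.
Qed.

(** j in terms of T: the inverse of R undoes the twist by R in T. *)
Lemma sw_tgt_antipode a : \sw_(r1, r2 <- R) T (act r2 a) * inH A (antipode r1)
  = inA a.
Proof.
transitivity (\sw_(r11, r12 <- R) \sw_(r21, r22 <- R)
   inA (act (r12 * r22) a) * inH A (r11 * antipode r21)).
  rewrite swap_sw; apply: eq_sw => p q; rewrite tgtE sw_mull; apply: eq_sw => r s.
  by rewrite -mulrA -inHM act_comp.
rewrite (sw_R_invr qtR (F := fun p q => inA (act q a) * inH A p)); last by lin.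
by rewrite act_id inH1 mulr1.
Qed.

(** With X(h) the right-hand side, h_1 X(h_2) = eps(h) T(a); multiplying by S on
    the left gives X. *)
Lemma inH_antipode_tgt h a : inH A (antipode h) * T a
  = \sw_(h1, h2 <- comul h) T (act (antipode h1) a) * inH A (antipode h2).
Proof.
pose X g := \sw_(h1, h2 <- comul g) T (act (antipode h1) a) * inH A (antipode h2).
have XL : linear X by rewrite /X; lin.
have XE g : \sw_(h1, h2 <- comul g) inH A h1 * X h2 = counit g *: T a.
  transitivity (\sw_(g1, g2 <- comul g) \sw_(g11, g12 <- comul g1)
    \sw_(p, q <- comul g12) T (act (p * antipode q) a) * inH A (g11 * antipode g2)).
    rewrite -(sw_comulA4 (F := fun p q r s =>
      T (act (q * antipode r) a) * inH A (p * antipode s))); try by lin.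
    apply: eq_sw => h1 h2; rewrite sw_mulr swap_sw; apply: eq_sw => h21 h22.
    rewrite mulrA inH_tgt sw_mull; apply: eq_sw => p q.
    by rewrite -mulrA -inHM act_comp.
  under eq_sw => g1 g2.
    under eq_sw => g11 g12.
      rewrite (sw_antipoder (G := fun z => T (act z a) * _)); last by lin.
      rewrite act_id. over.
    rewrite (sw_counitr (G := fun z => T a * inH A (z * antipode g2)));
      last by lin.
    over.
  rewrite (sw_antipoder (G := fun z => T a * inH A z)); last by lin.
  by rewrite inH1 mulr1.
transitivity (\sw_(h1, h2 <- comul h) \sw_(h21, h22 <- comul h2)
   inH A (antipode h1) * (inH A h21 * X h22)).
  under [RHS]eq_sw => h1 h2.
    rewrite -sw_mulr XE (linZ (f := fun z => inH A (antipode h1) * z));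
      last by lin.
    over.
  by rewrite (sw_counitr (G := fun z => inH A (antipode z) * T a)) //; lin.
rewrite -(sw_comulA (F := fun h1 h21 h22 =>
   inH A (antipode h1) * (inH A h21 * X h22))); try by lin.
under eq_sw => h1 h2.
  under eq_sw => h11 h12 do rewrite mulrA -inHM.
  rewrite (sw_antipodel (G := fun z => inH A z * X h2)); last by lin.
  rewrite inH1 mul1r. over.
exact: sw_counitl.
Qed.

Hypothesis qcA : quantum_commutative A R.

(** By a hexagon identity T(a) j(b) = R_1^2.(R_2^2.a) (R_1^1.b) # R_2^1, where
    quantum commutativity contracts the copy R_1. *)
Lemma tgt_inA a b : T a * inA b = inA b * T a.
Proof.
transitivity (\sw_(r1, r2 <- R) \sw_(p, q <- comul r1)
   inA (act r2 a * act p b) * inH A q).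
  rewrite tgtE sw_mull; apply: eq_sw => p q.
  rewrite -mulrA inH_inA sw_mulr; apply: eq_sw => r s.
  by rewrite mulrA inAM.
rewrite (sw_hexl qtR (F := fun p q r => inA (act r a * act p b) * inH A q));
  try by lin.
rewrite swap_sw tgtE sw_mulr; apply: eq_sw => p q.
rewrite mulrA -inAM (qcA b) -sw_mull; congr (_ * _).
rewrite (sw_lin (f := @inA k H A)); last by lin.
by apply: eq_sw => r s; rewrite act_comp.
Qed.

Lemma tgtM a b : T (a * b) = T b * T a.
Proof.
transitivity (\sw_(r1, r2 <- R) \sw_(p, q <- comul r2)
   inA (act p a * act q b) * inH A r1).
  rewrite tgtE; apply: eq_sw => p q; rewrite act_mul.
  by rewrite (sw_lin (f := fun z => inA z * inH A p)) //; lin.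
rewrite (sw_hexr qtR (F := fun r p q => inA (act p a * act q b) * inH A r));
  try by lin.
rewrite [in T a]tgtE sw_mulr swap_sw; apply: eq_sw => p q.
rewrite mulrA tgt_inA -mulrA tgtE sw_mull sw_mulr; apply: eq_sw => r s.
by rewrite inAM inHM !mulrA.
Qed.

Lemma lact_tgt a b : lact (T a) b = b * a.
Proof.
rewrite qcA tgtE (sw_lin (f := fun s : smash A => lact s b)); last by lin.
by apply: eq_sw => p q; rewrite lactM lact_inA lact_inH.
Qed.

End Target.

End SmashAlgebraTheory.

(** * Legs in the triple tensor product *)

Section Legs.

Variables (k : fieldType) (L : falgType k).
Implicit Types s t : tensor L L.
Implicit Types a b : L.

Lemma leg12E t : leg12 t = t \ox 1.
Proof. by rewrite [in RHS](tens_sum t) sw_tensl. Qed.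

Lemma leg13_tens a b : leg13 (a \ox b) = a \ox 1 \ox b.
Proof. by apply: sw_tens; lin. Qed.

Lemma leg23_tens a b : leg23 (a \ox b) = 1 \ox a \ox b.
Proof. by apply: sw_tens; lin. Qed.

Lemma flip_tens a b : flip (a \ox b) = b \ox a.
Proof. by apply: sw_tens; lin. Qed.

Lemma leg12M s t : leg12 (s * t) = leg12 s * leg12 t.
Proof. by rewrite !leg12E tensM mulr1. Qed.

Lemma leg13M s t : leg13 (s * t) = leg13 s * leg13 t.
Proof.
apply: tens_hom => [|a b c d]; first by lin.
by rewrite !leg13_tens !tensM !mulr1.
Qed.

Lemma leg23M s t : leg23 (s * t) = leg23 s * leg23 t.
Proof.
apply: tens_hom => [|a b c d]; first by lin.
by rewrite !leg23_tens !tensM !mulr1.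
Qed.

Lemma flipM s t : flip (s * t) = flip s * flip t.
Proof.
apply: tens_hom => [|a b c d]; first by lin.
by rewrite !flip_tens !tensM.
Qed.

Lemma leg23_comm a t : leg23 t * (a \ox 1 \ox 1) = (a \ox 1 \ox 1) * leg23 t.
Proof.
rewrite /leg23 sw_mull sw_mulr; apply: eq_sw => p q.
by rewrite !tensM !mulr1 !mul1r.
Qed.

End Legs.

(** * The coproduct of the smash product *)

Section WeakHopf.

Variables (k : fieldType) (H : hopfAlg k) (R : tensor H H).
Hypothesis qtR : quasitriangular R.
Variable A : modAlg H.
Hypothesis qcA : quantum_commutative A R.
Variables (x : tensor A A) (alpha : A -> k).
Hypothesis sepx : symmetric_separability_idempotent x.
Hypothesis alphaL : scalar alpha.
Hypothesis alphax : \sw_(x1, x2 <- x) alpha x1 *: x2 = 1.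
Hypothesis u_trivial : forall a : A, act (drinfeld R) a = a.
Implicit Types a b c : A.
Implicit Types h g : H.
Implicit Types W : lmodType k.
Local Notation L := (smash A).
Implicit Types l m : L.
Local Notation T := (@tgt k H A R).
Local Notation Dt := (@smash_comul k H A R x).
Local Notation epst := (@smash_counit k H A alpha).
Local Notation St := (@smash_antipode k H A R).
Local Notation HH := (@inHH k H A).
Local Notation DH h := (HH (comul h)).
Local Notation E := (@sep_smash k H A R x).

Lemma smash_ext W (f g : L -> W) : linear f -> linear g ->
  (forall a h, f (inA a * inH A h) = g (inA a * inH A h)) -> f =1 g.
Proof.
move=> fL gL fg; elim/smash_gen => [|s t|//].
  by have := linZ 0 0 fL; have := linZ 0 0 gL; rewrite !scale0r => -> ->.
by have := fL 1 s t; have := gL 1 s t; rewrite !scale1r => -> -> -> ->.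
Qed.

Lemma inHH_linear : linear HH. Proof. by rewrite /HH; lin. Qed.

Lemma inHH_tens g h : HH (g \ox h) = inH A g \ox inH A h.
Proof. by apply: sw_tens; lin. Qed.

Lemma inHHM s t : HH (s * t) = HH s * HH t.
Proof.
apply: tens_hom => [|a b c d]; first exact: inHH_linear.
by rewrite !inHH_tens tensM -!inHM.
Qed.

Lemma inHH1 : HH 1 = 1. Proof. exact: inHH_tens. Qed.

Lemma flip_inHH t : flip (HH t) = HH (flip t).
Proof.
rewrite {1}/HH /HH (sw_lin (f := @flip _ _ _)); last by lin.
by rewrite sw_flip; [apply: eq_sw => a b; rewrite flip_tens | lin].
Qed.

Lemma inHH_comulM g h : DH (g * h) = DH g * DH h.
Proof. by rewrite (comulM (hopfP H)) inHHM. Qed.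

Lemma inHH_comul1 : DH 1 = 1.
Proof. by rewrite (comul1 (hopfP H)) inHH1. Qed.

(** The form in which the coproduct is used: the sums over x and over R in its
    definition are gathered into the fixed element E. *)
Lemma smash_comulG a h : Dt (inA a * inH A h) = (inA a \ox 1) * E * DH h.
Proof.
rewrite -smelE smash_comulE /sep_smash (sw_mulr _ _ (inA a \ox 1)) sw_mull.
apply: eq_sw => x1 x2; rewrite /HH sw_mulr swap_sw; apply: eq_sw => h1 h2.
rewrite !tensM mul1r -smelE tgtE sw_mulr sw_mull sw_tensl; apply: eq_sw => r1 r2.
by rewrite smelE inAM inHM !mulrA.
Qed.

Lemma sw_smash_comul W (F : L -> L -> W) a h : bilin F ->
  \sw_(p, q <- Dt (inA a * inH A h)) F p q
  = \sw_(x1, x2 <- x) \sw_(h1, h2 <- comul h)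
      F (inA a * T x1 * inH A h1) (inA x2 * inH A h2).
Proof.
move=> FL;
  rewrite smash_comulG /sep_smash (sw_mulr _ _ (inA a \ox 1)) sw_mull sw_sw.
apply: eq_sw => x1 x2; rewrite /HH sw_mulr sw_sw; apply: eq_sw => h1 h2.
by rewrite !tensM mul1r sw_tens.
Qed.

Lemma smash_comul_inA a : Dt (inA a) = (inA a \ox 1) * E.
Proof. by have := smash_comulG a 1; rewrite inH1 inHH_comul1 !mulr1. Qed.

Lemma smash_comul_inH h : Dt (inH A h) = E * DH h.
Proof. by have := smash_comulG 1 h; rewrite inA1 !mul1r. Qed.

Lemma smash_comul1 : Dt 1 = E.
Proof. by have := smash_comul_inA 1; rewrite inA1 mul1r. Qed.

(** The product of E with itself is y^1 x^1 (x) x^2 y^2, in which x collapses to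
    x^2 x^1 = 1 by separability. *)
Lemma sep_smash_idem : E * E = E.
Proof.
transitivity (\sw_(x1, x2 <- x) \sw_(y1, y2 <- x)
    T (y1 * x1) \ox inA (x2 * y2)).
  rewrite {1}/sep_smash sw_mull; apply: eq_sw => x1 x2.
  rewrite /sep_smash sw_mulr; apply: eq_sw => y1 y2.
  by rewrite tensM (tgtM qtR) // inAM.
under eq_sw => x1 x2.
  rewrite (sw_sepr sepx (F := fun p q => T p \ox inA (x2 * q))); last by lin.
  under eq_sw do rewrite mulrA.
  over.
rewrite swap_sw; apply: eq_sw => y1 y2.
rewrite (sw_sep1C sepx (G := fun z => T y1 \ox inA (z * y2))) ?mul1r //; lin.
Qed.

Lemma sep_smash_inA a : E * (inA a \ox 1) = (inA a \ox 1) * E.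
Proof.
rewrite /sep_smash sw_mull sw_mulr; apply: eq_sw => x1 x2.
by rewrite !tensM mulr1 mul1r tgt_inA.
Qed.

Lemma sep_smash_tgtr a : E * (1 \ox T a) = (1 \ox T a) * E.
Proof.
rewrite /sep_smash sw_mull sw_mulr; apply: eq_sw => x1 x2.
by rewrite !tensM mulr1 mul1r tgt_inA.
Qed.

Lemma sep_smash_tgtl a : E * (T a \ox 1) = E * (1 \ox inA a).
Proof.
rewrite /sep_smash !sw_mull.
under eq_sw do rewrite tensM -(tgtM qtR) // mulr1.
under [RHS]eq_sw do rewrite tensM mulr1 -inAM.
by rewrite (sw_sepl sepx (F := fun p q => T p \ox inA q)) //; lin.
Qed.

(** Moving i(h_1) past T(x^1) and i(h_2) past j(x^2) lets h_2 act on x^1 and h_3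
    on x^2. By invariance h_3 acts on x^1 as S(h_3), which cancels with h_2. *)
Lemma sep_smash_comulH h : E * DH h = DH h * E.
Proof.
symmetry.
transitivity (\sw_(x1, x2 <- x) \sw_(h1, h2 <- comul h)
    \sw_(h11, h12 <- comul h1) \sw_(h21, h22 <- comul h2)
    (T (act h12 x1) * inH A h11) \ox (inA (act h21 x2) * inH A h22)).
  rewrite /HH /sep_smash sw_mulr; apply: eq_sw => x1 x2.
  rewrite sw_mull; apply: eq_sw => h1 h2.
  rewrite tensM (inH_tgt qtR) sw_tensl; apply: eq_sw => h11 h12.
  by rewrite inH_inA sw_tensr.
rewrite swap_sw.
transitivity (\sw_(h1, h2 <- comul h) \sw_(h11, h12 <- comul h1)
    \sw_(h21, h22 <- comul h2) \sw_(x1, x2 <- x)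
    (T (act (h12 * antipode h21) x1) * inH A h11) \ox (inA x2 * inH A h22)).
  apply: eq_sw => h1 h2; rewrite swap_sw; apply: eq_sw => h11 h12.
  rewrite swap_sw; apply: eq_sw => h21 h22.
  rewrite (sw_actr qtR sepx alphaL alphax u_trivial (F := fun p q =>
    (T (act h12 p) * inH A h11) \ox (inA q * inH A h22))); last by lin.
  by apply: eq_sw => x1 x2; rewrite act_comp.
rewrite (sw_comulA4 (F := fun h11 h12 h21 h22 => \sw_(x1, x2 <- x)
    (T (act (h12 * antipode h21) x1) * inH A h11) \ox (inA x2 * inH A h22)));
  try by lin.
transitivity (\sw_(h1, h2 <- comul h) \sw_(x1, x2 <- x)
    (T x1 * inH A h1) \ox (inA x2 * inH A h2)).
  apply: eq_sw => h1 h2.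
  under eq_sw => h11 h12.
    rewrite (sw_antipoder (G := fun z => \sw_(x1, x2 <- x)
      (T (act z x1) * inH A h11) \ox (inA x2 * inH A h2))); last by lin.
    over.
  rewrite (sw_counitr (G := fun z => \sw_(x1, x2 <- x)
      (T (act 1 x1) * inH A z) \ox (inA x2 * inH A h2))); last by lin.
  by apply: eq_sw => x1 x2; rewrite act_id.
rewrite swap_sw /sep_smash sw_mull; apply: eq_sw => x1 x2.
by rewrite /HH sw_mulr; apply: eq_sw => h1 h2; rewrite tensM.
Qed.

Lemma inHH_comul_inA h a :
  DH h * (inA a \ox 1) = \sw_(h1, h2 <- comul h) (inA (act h1 a) \ox 1) * DH h2.
Proof.
transitivity (\sw_(h1, h2 <- comul h) \sw_(h11, h12 <- comul h1)
    (inA (act h11 a) * inH A h12) \ox inH A h2).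
  rewrite /HH sw_mull; apply: eq_sw => h1 h2.
  by rewrite tensM inH_inA mulr1 sw_tensl.
rewrite (sw_comulA (F := fun p q r => (inA (act p a) * inH A q) \ox inH A r));
  try by lin.
apply: eq_sw => h1 h2; rewrite /HH sw_mulr; apply: eq_sw => p q.
by rewrite tensM mul1r.
Qed.

Lemma smash_comulM l m : Dt (l * m) = Dt l * Dt m.
Proof.
move: l; apply: smash_ext; [by lin | by lin |] => a h.
move: m; apply: smash_ext; [by lin | by lin |] => b g.
transitivity (\sw_(h1, h2 <- comul h)
   Dt (inA (a * act h1 b) * inH A (h2 * g))).
  rewrite -(sw_lin (f := Dt)); last by lin.
  congr (Dt _); rewrite mulrA -[_ * inA b]mulrA inH_inA sw_mulr sw_mull.
  by apply: eq_sw => p q; rewrite inAM inHM !mulrA.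
rewrite !smash_comulG.
(* E commutes with the coproducts of H and with A (x) 1, so that its two copies
   meet. *)
transitivity ((inA a \ox 1) * E * (DH h * (inA b \ox 1)) * (E * DH g));
  last by rewrite !mulrA.
rewrite inHH_comul_inA sw_mulm.
apply: eq_sw => p q; rewrite smash_comulG inHH_comulM.
have -> : inA (a * act p b) \ox 1 = (inA a \ox 1) * (inA (act p b) \ox 1)
  :> tensor L L.
  by rewrite tensM mulr1 -inAM.
rewrite !mulrA -(mulrA _ E (inA _ \ox 1)) sep_smash_inA !mulrA; congr (_ * _).
rewrite -[RHS]mulrA -sep_smash_comulH [RHS]mulrA; congr (_ * _).
by rewrite -[RHS]mulrA sep_smash_idem.
Qed.

(** T is the target map: its coproduct lives in the second leg. *)
Lemma smash_comul_tgt a : Dt (T a) = E * (1 \ox T a).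
Proof.
transitivity (\sw_(r1, r2 <- R) \sw_(p, q <- comul r1)
    E * ((inA (act r2 a) * inH A p) \ox inH A q)).
  rewrite tgtE (sw_lin (f := Dt)); last by lin.
  apply: eq_sw => r1 r2; rewrite smash_comulG -sep_smash_inA -mulrA -sw_mulr.
  congr (_ * _); rewrite /HH sw_mulr; apply: eq_sw => p q.
  by rewrite tensM mul1r.
rewrite (sw_hexl qtR (F := fun p q r =>
    E * ((inA (act r a) * inH A p) \ox inH A q))); try by lin.
rewrite swap_sw.
transitivity (\sw_(r1, r2 <- R) E * (1 \ox (inA (act r2 a) * inH A r1))).
  apply: eq_sw => r1 r2;
    rewrite -[RHS](_ : E * (T (act r2 a) \ox 1) * (1 \ox inH A r1) = _).
    rewrite -mulrA tensM mulr1 mul1r -sw_mulr; congr (_ * _).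
    rewrite tgtE sw_tensl; apply: eq_sw => p q.
    by rewrite act_comp.
  by rewrite sep_smash_tgtl -mulrA tensM mulr1.
by rewrite -sw_mulr tgtE -sw_tensr.
Qed.

Definition Dleft (t : tensor L L) : tensor (tensor L L) L :=
  \sw_(a, b <- t) Dt a \ox b.
Definition Dright (t : tensor L L) : tensor (tensor L L) L :=
  \sw_(a, b <- t) (a \ox 1 \ox 1) * leg23 (Dt b).

Lemma Dleft_tens l m : Dleft (l \ox m) = Dt l \ox m.
Proof. by apply: sw_tens; lin. Qed.

Lemma Dright_tens l m : Dright (l \ox m) = (l \ox 1 \ox 1) * leg23 (Dt m).
Proof. by apply: sw_tens; lin. Qed.

Lemma Dleft_linear : linear Dleft. Proof. by rewrite /Dleft; lin. Qed.
Lemma Dright_linear : linear Dright. Proof. by rewrite /Dright; lin. Qed.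

Lemma DleftM s t : Dleft (s * t) = Dleft s * Dleft t.
Proof.
apply: tens_hom => [|a b c d]; first exact: Dleft_linear.
by rewrite !Dleft_tens smash_comulM tensM.
Qed.

Lemma DrightM s t : Dright (s * t) = Dright s * Dright t.
Proof.
apply: tens_hom => [|a b c d]; first exact: Dright_linear.
rewrite !Dright_tens smash_comulM leg23M.
have -> : (a * c) \ox 1 \ox 1 = (a \ox 1 \ox 1) * (c \ox 1 \ox 1)
    :> tensor (tensor L L) L by rewrite !tensM !mulr1.
by rewrite !mulrA; congr (_ * _); rewrite -!mulrA leg23_comm.
Qed.

Lemma Dleft_sep : Dleft E = leg12 E * leg23 E.
Proof.
rewrite {1}/sep_smash (sw_lin _ _ Dleft_linear) {2}/sep_smash /leg23 sw_sw
  sw_mulr.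
apply: eq_sw => x1 x2; rewrite Dleft_tens smash_comul_tgt sw_tens; last by lin.
by rewrite leg12E tensM mul1r.
Qed.

Lemma Dright_sep : Dright E = leg12 E * leg23 E.
Proof.
rewrite {1}/sep_smash (sw_lin _ _ Dright_linear) leg12E {1}/sep_smash sw_tensl
  sw_mull.
apply: eq_sw => x1 x2; rewrite Dright_tens smash_comul_inA leg23M leg23_tens.
by rewrite mulrA !tensM !mulr1 !mul1r.
Qed.

Lemma sep_leg12_leg23 : leg12 E * leg23 E = leg23 E * leg12 E.
Proof.
rewrite leg12E {2}/sep_smash {2}/sep_smash /leg23 !sw_sw sw_mulr sw_mull.
apply: eq_sw => x1 x2; rewrite sw_tens; last by lin.
by rewrite !tensM !mul1r !mulr1 sep_smash_tgtr.
Qed.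

Lemma Dleft_comulH h : Dleft (DH h)
  = leg12 E * \sw_(h1, h2 <- comul h) DH h1 \ox inH A h2.
Proof.
rewrite /HH (sw_lin _ _ Dleft_linear) sw_mulr; apply: eq_sw => h1 h2.
by rewrite Dleft_tens smash_comul_inH leg12E tensM mul1r.
Qed.

Lemma Dright_comulH h : Dright (DH h)
  = leg23 E * \sw_(h1, h2 <- comul h) (inH A h1 \ox 1 \ox 1) * leg23 (DH h2).
Proof.
rewrite /HH (sw_lin _ _ Dright_linear) sw_mulr; apply: eq_sw => h1 h2.
by rewrite Dright_tens smash_comul_inH leg23M !mulrA leg23_comm.
Qed.

(** Both iterated coproducts of j(a) i(h) are
    (j(a) (x) 1 (x) 1) E^12 E^23 (i(h_1) (x) i(h_2) (x) i(h_3)). *)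
Lemma Dleft_Dright t : Dleft (Dt t) = Dright (Dt t).
Proof.
move: t; apply: smash_ext.
- by apply: lin_comp; [exact: Dleft_linear | lin].
- by apply: lin_comp; [exact: Dright_linear | lin].
move=> a h; rewrite smash_comulG.
rewrite ![Dleft (_ * _)]DleftM ![Dright (_ * _)]DrightM.
rewrite Dleft_tens Dright_tens smash_comul_inA smash_comul1 Dleft_sep Dright_sep
  Dleft_comulH Dright_comulH.
have -> : ((inA a \ox 1) * E) \ox 1 = (inA a \ox 1 \ox 1) * leg12 E
  :> tensor (tensor L L) L by rewrite leg12E tensM mulr1.
have -> : \sw_(h1, h2 <- comul h) DH h1 \ox inH A h2
  = \sw_(h1, h2 <- comul h) (inH A h1 \ox 1 \ox 1) * leg23 (DH h2).
  transitivity (\sw_(h1, h2 <- comul h) \sw_(p, q <- comul h1)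
     inH A p \ox inH A q \ox inH A h2).
    by apply: eq_sw => h1 h2; rewrite /HH sw_tensl.
  rewrite (sw_comulA (F := fun p q r => inH A p \ox inH A q \ox inH A r));
    try by lin.
  apply: eq_sw => h1 h2; rewrite /HH (sw_lin (f := @leg23 _ _)); last by lin.
  rewrite sw_mulr; apply: eq_sw => p q.
  by rewrite leg23_tens !tensM mul1r mulr1 mul1r.
have pp : leg12 E * leg12 E = leg12 E by rewrite -leg12M sep_smash_idem.
have qq : leg23 E * leg23 E = leg23 E by rewrite -leg23M sep_smash_idem.
(* What remains is a computation with two commuting idempotents, which are made
   abstract so that no product of tensors is unfolded. *)
move: (leg12 E) (leg23 E) (inA a \ox 1 \ox 1) pp qq sep_leg12_leg23 => p q X pp qq pq.
set S := \sw_(h1, h2 <- _) _; move: S => S.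
transitivity (X * (p * p * q * p) * S); first by rewrite !mulrA.
transitivity (X * (q * p * q * q) * S); last by rewrite !mulrA.
congr (_ * _ * _).
have -> : p * p * q * p = p * q by rewrite pp -mulrA -pq mulrA pp.
by rewrite -pq -mulrA qq -mulrA qq.
Qed.

Lemma Dright_def t : Dright t = \sw_(a, b <- t) \sw_(c, d <- Dt b) a \ox c \ox d.
Proof.
apply: eq_sw => a b; rewrite /leg23 sw_mulr; apply: eq_sw => c d.
by rewrite !tensM !mulr1 !mul1r.
Qed.

(** * Counit and antipode *)

Lemma smash_counit_lact l : epst l = alpha (lact l 1).
Proof.
apply: (smash_ext (W := k^o) (f := epst) (g := fun l => alpha (lact l 1)));
  try by lin.
move=> a h; rewrite -{1}smelE smash_counitE // lactM lact_inA lact_inH act_one.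
by rewrite -scalerAr mulr1 (linZ (W := k^o) (f := alpha)) 1?mulrC //; lin.
Qed.

Lemma smash_coalgebra : is_coalgebra Dt epst.
Proof.
split; try by lin.
- by move=> c; rewrite -Dright_def -Dleft_Dright.
- apply: smash_ext; try by lin.
  move=> a h; rewrite (sw_smash_comul (F := fun p q => epst p *: q)); last by lin.
  transitivity (\sw_(h1, h2 <- comul h) inA (a * act h1 1) * inH A h2).
    rewrite swap_sw; apply: eq_sw => h1 h2.
    rewrite -(sw_frobCl sepx alphaL alphax (G := fun z => inA z * inH A h2));
      last by lin.
    apply: eq_sw => x1 x2;
      rewrite smash_counit_lact !lactM lact_inH lact_tgt // lact_inA.
    by rewrite mulrA.
  rewrite -(sw_counitl (G := fun z => inA a * inH A z)); last by lin.
  by apply: eq_sw => p q;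
    rewrite act_one -scalerAr mulr1 (linZ (f := @inA _ _ _)) ?scalerAl //; lin.
- apply: smash_ext; try by lin.
  move=> a h; rewrite (sw_smash_comul (F := fun p q => epst q *: p)); last by lin.
  transitivity (\sw_(h1, h2 <- comul h) inA a * T (act h2 1) * inH A h1).
    rewrite swap_sw; apply: eq_sw => h1 h2.
    rewrite -(sw_frobr sepx alphaL alphax (G := fun z => inA a * T z * inH A h1));
      last by lin.
    by apply: eq_sw => x1 x2; rewrite smash_counit_lact !lactM lact_inH lact_inA.
  rewrite -(sw_counitr (G := fun z => inA a * inH A z)); last by lin.
  apply: eq_sw => p q; rewrite act_one (linZ (f := T)); last by lin.
  by rewrite (tgt1 _ qtR) -scalerAr mulr1 scalerAl.
Qed.

Lemma smash_counitMl l m n : epst (l * m * n)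
  = \sw_(m1, m2 <- Dt m) (epst (l * m1) * epst (m2 * n) : k^o).
Proof.
move: m; apply: (smash_ext (W := k^o)); try by lin.
move=> a h;
  rewrite (sw_smash_comul (W := k^o)
    (F := fun p q => epst (l * p) * epst (q * n)));
  last by lin.
rewrite smash_counit_lact !lactM swap_sw.
set z := lact n 1.
transitivity (\sw_(h1, h2 <- comul h)
  (alpha (lact l (a * (act h1 1 * act h2 z))) : k^o)).
  rewrite -(sw_lin (W' := k^o) (f := fun z => alpha (lact l (a * z))));
    last by lin.
  by rewrite -act_mul mul1r lact_inH lact_inA.
apply: (eq_sw (W := k^o)) => h1 h2.
rewrite -(sw_frobr (W := k^o) sepx alphaL alphax
  (G := fun z => alpha (lact l (a * (act h1 1 * z))))); last by lin.
apply: (eq_sw (W := k^o)) => x1 x2;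
  rewrite !smash_counit_lact !lactM !lact_inH !lact_inA.
by rewrite lact_tgt // mulrC.
Qed.

Lemma smash_counitMr l m n : epst (l * m * n)
  = \sw_(m1, m2 <- Dt m) (epst (l * m2) * epst (m1 * n) : k^o).
Proof.
move: m; apply: (smash_ext (W := k^o)); try by lin.
move=> a h;
  rewrite (sw_smash_comul (W := k^o)
    (F := fun p q => epst (l * q) * epst (p * n)));
  last by lin.
rewrite smash_counit_lact !lactM swap_sw.
set z := lact n 1.
transitivity (\sw_(h1, h2 <- comul h)
  (alpha (lact l (a * (act h1 z * act h2 1))) : k^o)).
  rewrite -(sw_lin (W' := k^o) (f := fun z => alpha (lact l (a * z))));
    last by lin.
  by rewrite -act_mul mulr1 lact_inH lact_inA.
apply: (eq_sw (W := k^o)) => h1 h2; rewrite mulrA.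
rewrite -(sw_frobCl (W := k^o) sepx alphaL alphax
  (G := fun z => alpha (lact l (z * act h2 1)))); last by lin.
apply: (eq_sw (W := k^o)) => x1 x2;
  rewrite !smash_counit_lact !lactM !lact_inH !lact_inA.
by rewrite lact_tgt // mulrA mulrC.
Qed.

Lemma smash_antipodeG a h : St (inA a * inH A h) = inH A (antipode h) * T a.
Proof. by rewrite -smelE smash_antipodeE. Qed.

(** The antipode sends T(a) to j(a). Moving i(S(R^1)) past T produces S(u), which
    acts trivially, and the expression of j in terms of T. *)
Lemma sw_antipode_tgt a :
  \sw_(r1, r2 <- R) inH A (antipode r1) * T (act r2 a) = inA a.
Proof.
transitivity (\sw_(r1, r2 <- R) \sw_(p, q <- comul r1)
    T (act (antipode p) (act r2 a)) * inH A (antipode q)).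
  by apply: eq_sw => r1 r2; rewrite (inH_antipode_tgt qtR).
rewrite (sw_hexl qtR (F := fun p q r =>
    T (act (antipode p) (act r a)) * inH A (antipode q))); try by lin.
rewrite swap_sw -(sw_tgt_antipode qtR); apply: eq_sw => r1 r2.
under eq_sw do rewrite -act_comp mulrA act_comp.
by rewrite (act_antipode_drinfeld qtR sepx alphaL alphax u_trivial
  (G := fun z => T z * inH A (antipode r1))) //; lin.
Qed.

Lemma smash_antipode_tgt a b h : St (inA a * T b * inH A h)
  = inH A (antipode h) * inA b * T a.
Proof.
transitivity (\sw_(r1, r2 <- R) St (inA (a * act r2 b) * inH A (r1 * h))).
  rewrite -(sw_lin (f := St)); last by lin.
  congr (St _); rewrite [T b]tgtE sw_mulm; apply: eq_sw => p q.
  by rewrite inAM inHM !mulrA.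
under eq_sw do rewrite smash_antipodeG antipodeM inHM (tgtM qtR qcA) -mulrA.
rewrite -sw_mulr -mulrA; congr (_ * _).
under eq_sw do rewrite mulrA.
by rewrite -sw_mull sw_antipode_tgt.
Qed.

Lemma sw_smash_comul1 W (F : L -> L -> W) : bilin F ->
  \sw_(p, q <- Dt 1) F p q = \sw_(x1, x2 <- x) F (T x1) (inA x2).
Proof.
by move=> FL; rewrite smash_comul1 sw_sw; apply: eq_sw => x1 x2; rewrite sw_tens.
Qed.

Lemma smash_antipoder l :
  \sw_(l1, l2 <- Dt l) l1 * St l2 = \sw_(e1, e2 <- Dt 1) epst (e1 * l) *: e2.
Proof.
rewrite (sw_smash_comul1 (F := fun p q => epst (p * l) *: q)); last by lin.
move: l; apply: smash_ext; try by lin.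
move=> a h; rewrite (sw_smash_comul (F := fun p q => p * St q)); last by lin.
transitivity (counit h *: inA a).
  transitivity (\sw_(x1, x2 <- x) counit h *: (inA a * T (x2 * x1))).
    apply: eq_sw => x1 x2; rewrite (tgtM qtR qcA) mulrA.
    rewrite -[inA a * T x1 * _]mulr1 -mulrA -[X in _ *: X]mulrA.
    transitivity (\sw_(h1, h2 <- comul h)
        inA a * T x1 * (inH A (h1 * antipode h2) * T x2)).
      by apply: eq_sw => h1 h2; rewrite smash_antipodeG inHM !mulrA.
    rewrite (sw_antipoder (G := fun z => inA a * T x1 * (inH A z * T x2)));
      last by lin.
    by rewrite inH1 mul1r mulr1 mulrA.
  rewrite (sw_sep1C sepx (G := fun z => counit h *: (inA a * T z))); last by lin.
  by rewrite (tgt1 _ qtR) mulr1.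
transitivity (inA (a * act h 1)).
  by rewrite act_one -scalerAr mulr1 (linZ (f := @inA _ _ _)) //; lin.
rewrite -(sw_frobCl sepx alphaL alphax (G := @inA _ _ _)); last by lin.
apply: eq_sw => x1 x2.
by rewrite smash_counit_lact !lactM lact_tgt // lact_inA lact_inH.
Qed.

Lemma smash_antipodel l :
  \sw_(l1, l2 <- Dt l) St l1 * l2 = \sw_(e1, e2 <- Dt 1) epst (l * e2) *: e1.
Proof.
rewrite (sw_smash_comul1 (F := fun p q => epst (l * q) *: p)); last by lin.
move: l; apply: smash_ext; try by lin.
move=> a h; rewrite (sw_smash_comul (F := fun p q => St p * q)); last by lin.
transitivity (T (act (antipode h) a)).
  transitivity (\sw_(x1, x2 <- x) \sw_(h1, h2 <- comul h)
      inH A (antipode h1) * T a * inA (x1 * x2) * inH A h2).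
    apply: eq_sw => x1 x2; apply: eq_sw => h1 h2.
    rewrite smash_antipode_tgt inAM !mulrA; congr (_ * _ * _).
    by rewrite -!mulrA tgt_inA.
  rewrite (sw_sep1 sepx (G := fun z => \sw_(h1, h2 <- comul h)
      inH A (antipode h1) * T a * inA z * inH A h2)); last by lin.
  under eq_sw do rewrite inA1 mulr1 (inH_antipode_tgt qtR) sw_mull.
  rewrite (sw_comulA (F := fun p q r =>
      T (act (antipode p) a) * inH A (antipode q) * inH A r)); try by lin.
  under eq_sw => h1 h2.
    under eq_sw do rewrite -mulrA -inHM.
    rewrite (sw_antipodel (G := fun z => T (act (antipode h1) a) * inH A z));
      last by lin.
    rewrite inH1 mulr1. over.
  by rewrite (sw_counitr (G := fun z => T (act (antipode z) a))) //; lin.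
rewrite -(sw_frobCr sepx alphaL alphax (G := T)); last by lin.
apply: eq_sw => x1 x2.
rewrite smash_counit_lact !lactM lact_inA lact_inH lact_inA mulr1.
by rewrite (alpha_adjS qtR sepx alphaL alphax u_trivial).
Qed.

(** S(l_1) l_2 is given by the previous axiom. Duality of x and alpha then moves
    the remaining copy of x into the argument of T, and what is left contracts to
    x^2 x^1 = 1. *)
Lemma smash_antipodeK l : \sw_(m, l3 <- Dt l)
    \sw_(l1, l2 <- Dt m) St l1 * l2 * St l3 = St l.
Proof.
transitivity (\sw_(m, l3 <- Dt l) \sw_(y1, y2 <- x)
    epst (m * inA y2) *: (T y1 * St l3)).
  apply: eq_sw => m l3; rewrite -sw_mull smash_antipodel.
  rewrite (sw_smash_comul1 (F := fun p q => epst (m * q) *: p)); last by lin.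
  by rewrite sw_mull; apply: eq_sw => y1 y2; rewrite scalerAl.
move: l; apply: smash_ext; try by lin.
move=> a h; rewrite (sw_smash_comul (F := fun m l3 => \sw_(y1, y2 <- x)
    epst (m * inA y2) *: (T y1 * St l3))); last by lin.
transitivity (\sw_(y1, y2 <- x) \sw_(h1, h2 <- comul h)
    T y1 * inH A (antipode h2) * T (act h1 y2) * T a).
  rewrite swap_sw [RHS]swap_sw; apply: eq_sw => h1 h2.
  rewrite swap_sw; apply: eq_sw => y1 y2.
  rewrite -[RHS]mulrA -(tgtM qtR qcA).
  rewrite -(sw_frobCl sepx alphaL alphax (G := fun z =>
    T y1 * inH A (antipode h2) * T z)); last by lin.
  apply: eq_sw => x1 x2;
    rewrite smash_antipodeG mulrA smash_counit_lact !lactM !lact_inA lact_inH.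
  by rewrite mulr1 lact_tgt // mulrA.
transitivity (\sw_(y1, y2 <- x) T (y2 * y1) * inH A (antipode h) * T a).
  apply: eq_sw => y1 y2; rewrite (tgtM qtR qcA).
  transitivity (\sw_(h1, h2 <- comul h) \sw_(p, q <- comul h2)
      T y1 * (T (act (antipode p * h1) y2) * inH A (antipode q)) * T a).
    apply: eq_sw => h1 h2.
    rewrite -(mulrA (T y1) _ (T (act h1 y2))) (inH_antipode_tgt qtR) sw_mulm.
    by apply: eq_sw => p q; rewrite act_comp.
  rewrite -(sw_comulA (F := fun h1 p q =>
      T y1 * (T (act (antipode p * h1) y2) * inH A (antipode q)) * T a));
    try by lin.
  under eq_sw => h1 h2.
    rewrite (sw_act_cancel qtR u_trivial (G := fun z =>
      T y1 * (T z * inH A (antipode h2)) * T a)); last by lin.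
    over.
  rewrite (sw_counitl (G := fun z =>
      T y1 * (T y2 * inH A (antipode z)) * T a)); last by lin.
  by rewrite !mulrA.
rewrite (sw_sep1C sepx (G := fun z => T z * inH A (antipode h) * T a));
  last by lin.
by rewrite (tgt1 _ qtR) mul1r smash_antipodeG.
Qed.

Lemma smash_weak_hopf : is_weak_hopf Dt epst St.
Proof.
split; try by lin.
- exact: smash_coalgebra.
- exact: smash_comulM.
- exact: smash_counitMl.
- exact: smash_counitMr.
- by rewrite -[LHS]/(Dleft (Dt 1)) smash_comul1 Dleft_sep.
- by rewrite -[LHS]/(Dleft (Dt 1)) smash_comul1 Dleft_sep sep_leg12_leg23.
- exact: smash_antipoder.
- exact: smash_antipodel.
- exact: smash_antipodeK.
Qed.

(** * The R-matrix of the smash product *)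

Local Notation RR := (@smash_Rmx k H A R x).

Lemma inHH_R_comul h : HH R * DH h = flip (DH h) * HH R.
Proof. by rewrite flip_inHH -!inHHM (qt_comulC qtR). Qed.

Local Notation RL := (HH R).
Local Notation E21 := (flip E).

Lemma flip_sep_smashE : E21 = \sw_(x1, x2 <- x) inA x1 \ox T x2.
Proof.
rewrite /sep_smash (sw_lin (f := @flip _ _ _)); last by lin.
under eq_sw do rewrite flip_tens.
by rewrite (sw_sym sepx (F := fun p q => inA q \ox T p)) //; lin.
Qed.

Lemma flip_sep_idem : E21 * E21 = E21.
Proof. by rewrite -flipM sep_smash_idem. Qed.

Lemma flip_sep_inAl a : E21 * (inA a \ox 1) = E21 * (1 \ox T a).
Proof.
by have := congr1 (@flip _ _ _) (sep_smash_tgtl a); rewrite !flipM !flip_tens.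
Qed.

Lemma flip_sep_inAr a : E21 * (1 \ox inA a) = (1 \ox inA a) * E21.
Proof.
by have := congr1 (@flip _ _ _) (sep_smash_inA a); rewrite !flipM !flip_tens.
Qed.

Lemma flip_sep_tgt a : E21 * (T a \ox 1) = (T a \ox 1) * E21.
Proof.
by have := congr1 (@flip _ _ _) (sep_smash_tgtr a); rewrite !flipM !flip_tens.
Qed.

Lemma smash_RmxE : RR = E21 * RL * E.
Proof.
rewrite /smash_Rmx smash_comul1 -mulrA [flip E]/flip sw_mull;
  apply: eq_sw => e1 e2.
rewrite mulrA /HH sw_mulm; apply: eq_sw => r1 r2.
rewrite [in RHS](tens_sum E) sw_mulr; apply: eq_sw => f1 f2.
by rewrite !tensM.
Qed.

(** T(a) moved to the right of the second leg of R, at the cost of a second copy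
    of R which the inverse in the opposite algebra absorbs. *)
Lemma sw_tgt_R a : \sw_(r1, r2 <- R) inH A r1 \ox (T a * inH A r2)
  = \sw_(r21, r22 <- R) \sw_(r11, r12 <- R)
      inH A (r21 * r11) \ox (inH A r12 * T (act (antipode r22) a)).
Proof.
symmetry.
transitivity (\sw_(r21, r22 <- R) \sw_(r11, r12 <- R) \sw_(r31, r32 <- R)
    inH A (r21 * (r11 * r31)) \ox (T (act (r12 * antipode r22) a) * inH A r32)).
  apply: eq_sw => r21 r22.
  transitivity (\sw_(r11, r12 <- R) \sw_(p, q <- comul r12)
      inH A (r21 * r11) \ox (T (act (q * antipode r22) a) * inH A p)).
    apply: eq_sw => r11 r12; rewrite (inH_tgt qtR) sw_tensr.
    by apply: eq_sw => p q; rewrite act_comp.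
  by rewrite (sw_hexr qtR (F := fun r p q => inH A (r21 * r) \ox
      (T (act (q * antipode r22) a) * inH A p))) //; lin.
under eq_sw do rewrite swap_sw.
rewrite swap_sw; apply: eq_sw => r31 r32.
under eq_sw => r21 r22 do under eq_sw do rewrite mulrA.
rewrite (sw_Rop_inv qtR (F := fun p q =>
  inH A (p * r31) \ox (T (act q a) * inH A r32))); last by lin.
by rewrite act_id mul1r.
Qed.

(** Moving T(x^2) to the right makes S(R^2) act on x^2; by invariance R^2 acts on
    x^1 instead, which turns j(x^1) into T(x^1). *)
Lemma flip_sep_R : E21 * RL
  = \sw_(x1, x2 <- x) \sw_(r1, r2 <- R)
      (T x1 * inH A r1) \ox (inH A r2 * T x2).
Proof.
transitivity (\sw_(x1, x2 <- x) \sw_(r21, r22 <- R) \sw_(r11, r12 <- R)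
    (inA x1 * inH A (r21 * r11)) \ox (inH A r12 * T (act (antipode r22) x2))).
  rewrite flip_sep_smashE sw_mull; apply: eq_sw => x1 x2.
  transitivity ((inA x1 \ox 1) *
      \sw_(r1, r2 <- R) inH A r1 \ox (T x2 * inH A r2)).
    rewrite /HH !sw_mulr; apply: eq_sw => r1 r2.
    by rewrite !tensM mul1r.
  rewrite sw_tgt_R sw_mulr; apply: eq_sw => r21 r22.
  by rewrite sw_mulr; apply: eq_sw => r11 r12; rewrite tensM mul1r.
rewrite swap_sw.
transitivity (\sw_(r21, r22 <- R) \sw_(x1, x2 <- x) \sw_(r11, r12 <- R)
    (inA (act r22 x1) * inH A (r21 * r11)) \ox (inH A r12 * T x2)).
  apply: eq_sw => r21 r22.
  by rewrite (sw_actl qtR sepx alphaL alphax u_trivial (F := fun p q =>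
    \sw_(r11, r12 <- R) (inA p * inH A (r21 * r11)) \ox (inH A r12 * T q))) //; lin.
rewrite swap_sw; apply: eq_sw => x1 x2; rewrite swap_sw; apply: eq_sw => r11 r12.
rewrite [T x1]tgtE sw_mull sw_tensl; apply: eq_sw => r21 r22.
by rewrite inHM mulrA.
Qed.

Lemma flip_sep_R_tgt a : E21 * RL * (1 \ox T a) = E21 * (T a \ox 1) * RL.
Proof.
transitivity (\sw_(r11, r12 <- R) E21 * (1 \ox T (act r12 a)) *
    (inH A r11 \ox 1) * RL).
  transitivity (E21 * \sw_(r11, r12 <- R) \sw_(r21, r22 <- R)
      inH A (r11 * r21) \ox (T (act r12 a) * inH A r22)).
    rewrite -mulrA; congr (_ * _).
    rewrite -(sw_hexr qtR (F := fun r p q =>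
      inH A r \ox (T (act q a) * inH A p))); try by lin.
    rewrite /HH sw_mull; apply: eq_sw => r1 r2.
    by rewrite tensM mulr1 (inH_tgt qtR) sw_tensr.
  rewrite sw_mulr; apply: eq_sw => r11 r12; rewrite -!mulrA; congr (_ * _).
  rewrite mulrA tensM mul1r mulr1 /HH sw_mulr; apply: eq_sw => r21 r22.
  by rewrite tensM inHM.
under eq_sw do rewrite -flip_sep_inAl.
rewrite -sw_mull; congr (_ * _).
under eq_sw do rewrite -mulrA tensM mulr1.
by rewrite -sw_mulr tgtE sw_tensl.
Qed.

Section Transparent.

Hypothesis muegerA : in_mueger_center A R.

Lemma sw_mueger_tgt a : \sw_(r1, r2 <- R) T (act r1 a) * inH A r2 = inA a.
Proof.
transitivity (\sw_(r11, r12 <- R) \sw_(r21, r22 <- R)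
    inA (act (r22 * r11) a) * inH A (r21 * r12)).
  apply: eq_sw => p q; rewrite tgtE sw_mull; apply: eq_sw => r s.
  by rewrite act_comp inHM mulrA.
rewrite (sw_mueger muegerA (F := fun c g => inA c * inH A g)); last by lin.
by rewrite inH1 mulr1.
Qed.

(** For transparent A, T can also be written with R^-1 in place of R, with the
    factors in the opposite order. *)
Lemma sw_mueger_inA a :
  \sw_(r1, r2 <- R) inH A r2 * inA (act (antipode r1) a) = T a.
Proof.
transitivity (\sw_(r1, r2 <- R) \sw_(p, q <- comul r2)
    inA (act (p * antipode r1) a) * inH A q).
  apply: eq_sw => r1 r2; rewrite inH_inA; apply: eq_sw => p q.
  by rewrite act_comp.
rewrite (sw_hexr qtR (F := fun r p q =>
    inA (act (p * antipode r) a) * inH A q)); try by lin.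
rewrite tgtE -(mueger_inv qtR muegerA (F := fun c g => inA c * inH A g));
  last by lin.
apply: eq_sw => r11 r12.
under eq_sw do rewrite antipodeM mulrA act_comp.
by rewrite (mueger_R2S qtR u_trivial muegerA
  (G := fun c => inA c * inH A r12)) //; lin.
Qed.

(** Moving T(x^1) to the left through R_L makes a copy of R^1 act on x^1; by
    invariance it acts on x^2 as S(R^1), which for transparent A turns j(x^2)
    into T(x^2). The result is the expression found for E^21 R_L. *)
Lemma R_sep_smash : RL * E = E21 * RL.
Proof.
rewrite flip_sep_R.
transitivity (\sw_(r11, r12 <- R) \sw_(r21, r22 <- R) \sw_(x1, x2 <- x)
    (T (act r21 x1) * inH A r11) \ox (inH A (r12 * r22) * inA x2)).
  rewrite -(sw_hexl qtR (F := fun p q r => \sw_(x1, x2 <- x)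
    (T (act q x1) * inH A p) \ox (inH A r * inA x2))); try by lin.
  rewrite /HH sw_mull; apply: eq_sw => r1 r2.
  rewrite swap_sw /sep_smash sw_mulr; apply: eq_sw => x1 x2.
  by rewrite tensM (inH_tgt qtR) sw_tensl.
rewrite [RHS]swap_sw; apply: eq_sw => r11 r12.
transitivity (\sw_(r21, r22 <- R) \sw_(x1, x2 <- x)
    (T x1 * inH A r11) \ox (inH A r12 * (inH A r22 * inA (act (antipode r21) x2)))).
  apply: eq_sw => r21 r22.
  rewrite (sw_actl qtR sepx alphaL alphax u_trivial (F := fun p q =>
    (T p * inH A r11) \ox (inH A (r12 * r22) * inA q))); last by lin.
  by apply: eq_sw => x1 x2; rewrite inHM mulrA.
rewrite swap_sw; apply: eq_sw => x1 x2.
by rewrite -sw_tensr -sw_mulr sw_mueger_inA.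
Qed.

Lemma flip_sep_R_inA a : E21 * RL * (inA a \ox 1) = E21 * (1 \ox inA a) * RL.
Proof.
transitivity (\sw_(r11, r12 <- R) E21 * (inA (act r11 a) \ox 1) *
    (1 \ox inH A r12) * RL).
  transitivity (E21 * \sw_(r11, r12 <- R) \sw_(r21, r22 <- R)
      (inA (act r11 a) * inH A r21) \ox inH A (r12 * r22)).
    rewrite -mulrA; congr (_ * _).
    rewrite -(sw_hexl qtR (F := fun p q r =>
      (inA (act p a) * inH A q) \ox inH A r)); try by lin.
    rewrite /HH sw_mull; apply: eq_sw => r1 r2.
    by rewrite tensM mulr1 inH_inA sw_tensl.
  rewrite sw_mulr; apply: eq_sw => r11 r12; rewrite -!mulrA; congr (_ * _).
  rewrite mulrA tensM mul1r mulr1 /HH sw_mulr; apply: eq_sw => r21 r22.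
  by rewrite tensM inHM.
under eq_sw do rewrite flip_sep_inAl.
rewrite -sw_mull; congr (_ * _).
under eq_sw do rewrite -mulrA tensM mulr1.
by rewrite -sw_mulr -sw_tensr sw_mueger_tgt.
Qed.

Lemma smash_Rmx_l : RR = RL * E.
Proof. by rewrite smash_RmxE -R_sep_smash -mulrA sep_smash_idem. Qed.

Lemma smash_Rmx_r : RR = E21 * RL.
Proof. by rewrite smash_Rmx_l R_sep_smash. Qed.

Lemma smash_Rmx_comulC l : flip (Dt l) * RR = RR * Dt l.
Proof.
move: l; apply: smash_ext; try by lin.
move=> a h; rewrite smash_comulG !flipM flip_tens.
rewrite {1}smash_Rmx_l -!mulrA (mulrA (flip (DH h))) -inHH_R_comul.
rewrite -[RL * _ * E]mulrA -sep_smash_comulH.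
rewrite smash_Rmx_r !mulrA flip_sep_R_inA flip_sep_inAr.
by rewrite -!mulrA.
Qed.

Lemma Dright_R : Dright RL = leg13 RL * leg12 RL * leg23 E.
Proof.
transitivity (\sw_(r1, r2 <- R) \sw_(p, q <- comul r2)
    (inH A r1 \ox inH A p \ox inH A q) * leg23 E).
  rewrite /HH (sw_lin _ _ Dright_linear); apply: eq_sw => r1 r2.
  rewrite Dright_tens smash_comul_inH sep_smash_comulH.
  rewrite leg23M mulrA -sw_mull; congr (_ * _).
  rewrite /HH (sw_lin (f := @leg23 _ _)) ?sw_mulr; last by lin.
  by apply: eq_sw => p q; rewrite leg23_tens !tensM !mulr1 !mul1r.
rewrite (sw_hexr qtR (F := fun r p q =>
  (inH A r \ox inH A p \ox inH A q) * leg23 E)); try by lin.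
rewrite {1}/HH (sw_lin (f := @leg13 _ _)); last by lin.
rewrite -mulrA sw_mull; apply: eq_sw => r11 r12.
rewrite mulrA leg13_tens leg12E /HH sw_tensl sw_mulm; apply: eq_sw => r21 r22.
by rewrite !tensM mulr1 mul1r inHM.
Qed.

Lemma Dleft_R : Dleft RL = leg13 RL * leg23 RL * leg12 E.
Proof.
transitivity (\sw_(r1, r2 <- R) \sw_(p, q <- comul r1)
    (inH A p \ox inH A q \ox inH A r2) * leg12 E).
  rewrite /HH (sw_lin _ _ Dleft_linear); apply: eq_sw => r1 r2.
  rewrite Dleft_tens smash_comul_inH sep_smash_comulH.
  rewrite -sw_mull /HH leg12E -[inH A r2]mulr1 -tensM mulr1; congr (_ * _).
  by rewrite sw_tensl.
rewrite (sw_hexl qtR (F := fun p q r =>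
  (inH A p \ox inH A q \ox inH A r) * leg12 E)); try by lin.
rewrite {1}/HH (sw_lin (f := @leg13 _ _)); last by lin.
rewrite -mulrA sw_mull; apply: eq_sw => r11 r12.
rewrite mulrA leg13_tens /HH (sw_lin (f := @leg23 _ _)); last by lin.
rewrite sw_mulm; apply: eq_sw => r21 r22.
by rewrite leg23_tens !tensM mulr1 mul1r -inHM.
Qed.

(** E^23 becomes E^13 when it crosses an element that exchanges the second leg
    with the first one. *)
Lemma leg12_sep_transport (M : tensor L L) :
    (forall a, M * (1 \ox T a) = (T a \ox 1) * M) ->
  leg12 M * leg23 E = leg13 E * leg12 M.
Proof.
move=> MT; rewrite leg12E /sep_smash (sw_lin (f := @leg13 _ _)); last by lin.
rewrite (sw_lin (f := @leg23 _ _)); last by lin.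
rewrite sw_mulr sw_mull; apply: eq_sw => x1 x2.
by rewrite leg13_tens leg23_tens !tensM mul1r mulr1 MT.
Qed.

Lemma leg23_sep_transport (M : tensor L L) :
    (forall a, M * (inA a \ox 1) = (1 \ox inA a) * M) ->
  leg23 M * leg12 E = leg13 E * leg23 M.
Proof.
move=> MA; rewrite leg12E /sep_smash (sw_lin (f := @leg13 _ _)); last by lin.
rewrite sw_tensl sw_mulr sw_mull; apply: eq_sw => x1 x2.
have -> : T x1 \ox inA x2 \ox 1 = (T x1 \ox 1 \ox 1) * leg23 (inA x2 \ox 1).
  by rewrite leg23_tens !tensM !mulr1 mul1r.
have -> : leg13 (T x1 \ox inA x2) = (T x1 \ox 1 \ox 1) * leg23 (1 \ox inA x2).
  by rewrite leg13_tens leg23_tens !tensM !mulr1 mul1r.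
rewrite [LHS]mulrA leg23_comm -[LHS]mulrA -[RHS]mulrA.
by rewrite -(leg23M M) MA leg23M.
Qed.

Lemma smash_Rmx_tgt a : RR * (1 \ox T a) = (T a \ox 1) * RR.
Proof. by rewrite smash_Rmx_r flip_sep_R_tgt flip_sep_tgt mulrA. Qed.

Lemma smash_Rmx_inA a : RR * (inA a \ox 1) = (1 \ox inA a) * RR.
Proof. by rewrite smash_Rmx_r flip_sep_R_inA flip_sep_inAr mulrA. Qed.

Lemma smash_Rmx_comulr :
  \sw_(r1, r2 <- RR) \sw_(a, b <- Dt r2) r1 \ox a \ox b = leg13 RR * leg12 RR.
Proof.
rewrite -Dright_def {1}smash_Rmx_l DrightM.
rewrite Dright_R Dright_sep {1}smash_Rmx_l leg13M.
rewrite -[RHS]mulrA -(leg12_sep_transport smash_Rmx_tgt) smash_Rmx_l leg12M.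
have := sep_leg12_leg23; have : leg23 E * leg23 E = leg23 E.
  by rewrite -leg23M sep_smash_idem.
move: (leg12 E) (leg23 E) (leg13 RL) (leg12 RL) => p q r s qq pq.
by rewrite pq -!mulrA (mulrA q q) qq -pq.
Qed.

Lemma smash_Rmx_comull :
  \sw_(r1, r2 <- RR) Dt r1 \ox r2 = leg13 RR * leg23 RR.
Proof.
rewrite -[LHS]/(Dleft RR) {1}smash_Rmx_l.
rewrite DleftM Dleft_R.
rewrite Dleft_sep {1}smash_Rmx_l leg13M.
rewrite -[RHS]mulrA -(leg23_sep_transport smash_Rmx_inA) smash_Rmx_l leg23M.
have := sep_leg12_leg23; have : leg12 E * leg12 E = leg12 E.
  by rewrite -leg12M sep_smash_idem.
move: (leg12 E) (leg23 E) (leg13 RL) (leg23 RL) => p q r s pp pq.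
by rewrite -!mulrA (mulrA p p) pp pq.
Qed.

Lemma smash_quasitriangular :
  is_quasitriangular_weak_hopf Dt epst St RR.
Proof.
have RVR : HH R^-1 * RL = 1 by rewrite -inHHM mulVr ?(qt_unit qtR) // inHH1.
have RRV : RL * HH R^-1 = 1 by rewrite -inHHM mulrV ?(qt_unit qtR) // inHH1.
split.
- exact: smash_weak_hopf.
- by exists RL; rewrite smash_comul1 smash_RmxE.
- exact: smash_Rmx_comulC.
- exact: smash_Rmx_comulr.
- exact: smash_Rmx_comull.
exists (E * HH R^-1 * E21); rewrite smash_comul1; split;
  first by exists (HH R^-1).
- rewrite smash_Rmx_r -!mulrA (mulrA E21) flip_sep_idem -R_sep_smash.
  by rewrite (mulrA (HH _)) RVR mul1r sep_smash_idem.
- rewrite smash_Rmx_l -!mulrA (mulrA E E) sep_smash_idem.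
  by rewrite !mulrA R_sep_smash -(mulrA _ RL) RRV mulr1 flip_sep_idem.
Qed.

Lemma smash_triangular : triangular R -> is_triangular_weak_hopf Dt epst St RR.
Proof.
case=> _ R21R; split; first exact: smash_quasitriangular.
rewrite {1}smash_Rmx_l smash_Rmx_r flipM -mulrA (mulrA E21) flip_sep_idem
  -R_sep_smash.
by rewrite mulrA flip_inHH -inHHM R21R inHH1 mul1r smash_comul1.
Qed.

End Transparent.

End WeakHopf.

Theorem theorem3p5 (k : fieldType) (char0 : [pchar k] =i pred0)
    (H : hopfAlg k) (R : tensor H H)
    (qtR : quasitriangular R) (ssH : semisimple H)
    (A : modAlg H) (qcA : quantum_commutative A R)
    (x : tensor A A) (sepx : symmetric_separability_idempotent x)
    (alpha : {scalar A}) (alphax : \sw_(x1, x2 <- x) alpha x1 *: x2 = 1)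
    (u_trivial : forall a : A, act (drinfeld R) a = a) :
  is_weak_hopf (smash_comul R x) (smash_counit alpha) (smash_antipode R)
  /\ (in_mueger_center A R ->
        is_quasitriangular_weak_hopf (smash_comul R x) (smash_counit alpha)
          (smash_antipode R) (smash_Rmx R x)
        /\ (triangular R ->
              is_triangular_weak_hopf (smash_comul R x) (smash_counit alpha)
                (smash_antipode R) (smash_Rmx R x))).
Proof.
have alphaL : scalar alpha by exact: linearP.
split; first exact: smash_weak_hopf.
move=> muegerA; split; first exact: smash_quasitriangular.
exact: smash_triangular.
Qed.
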